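(* Let $(X,\mathcal B,\mu)$ be a probability space and let $\mathfrak U=\{U_k:\ k=1,2,\ldots,n\}$ be a set of invertible commuting measure-preserving transformations of $X$ of rank $d\ge1$. Then for every function $f\in L\log^{d-1}L(X)$ the averages $$\frac{1}{s_1\cdots s_n}\sum_{j_1=0}^{s_1-1}\cdots\sum_{j_n=0}^{s_n-1}f\left(U_1^{j_1}\cdots U_n^{j_n}x\right)$$ converge for almost every $x\in X$ as $\min_k s_k\to\infty$.
   Context: A measurable map $T:X\to X$ on a probability space $(X,\mathcal B,\mu)$ is measure-preserving if $T^{-1}(E)\in\mathcal B$ and $\mu(T^{-1}(E))=\mu(E)$ for every $E\in\mathcal B$. A set of invertible commuting measure-preserving transformations $\mathfrak U=\{U_k:\ k=1,\ldots,n\}$ is dependent if there are integers $p_1,\ldots,p_n$, not all zero, such that $(U_1^{p_1}\circ\cdots\circ U_n^{p_n})(x)=x$ for almost every $x\in X$; otherwise it is independent. The rank of $\mathfrak U$ is the largest integer $r$ for which there is an independent subset of cardinality $r$ in $\mathfrak U$. For an integer $m\ge1$, the class $L\log^mL(X)$ consists of the measurable functions $f$ on $X$ with $\Phi(|f|)\in L^1(X)$, where $\Phi(t)=t\left(1+\max\{0,(\log t)^m\}\right)$ (with $\Phi(0)=0$); and $L\log^0L(X)=L^1(X)$. The numbers $s_1,\ldots,s_n$ are positive integers tending to infinity independently (unrestricted multiple limit). *)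

(* Defs.v *)
From HB Require Import structures.
From mathcomp Require Import all_boot all_order all_algebra.
From mathcomp Require Import all_classical all_reals all_analysis.
Import Order.TTheory GRing.Theory Num.Theory.
Import numFieldNormedType.Exports.

Set Implicit Arguments.
Unset Strict Implicit.
Unset Printing Implicit Defensive.

Local Open Scope classical_set_scope.
Local Open Scope ring_scope.

Definition measure_preserving d (X : measurableType d) (R : realType)
    (mu : probability X R) (T : X -> X) : Prop :=
  measurable_fun setT T /\
  forall E : set X, measurable E -> mu (T @^-1` E) = mu E.

(* Invertibility is pointwise, with a measurable inverse; the inverse then
   preserves mu automatically. *)
Record invertible_mpt d (X : measurableType d) (R : realType)
    (mu : probability X R) := InvertibleMPT {
  mpt_fun :> X -> X ;
  mpt_inv : X -> X ;
  mpt_funP : measure_preserving mu mpt_fun ;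
  mpt_inv_measurable : measurable_fun setT mpt_inv ;
  mpt_funK : cancel mpt_fun mpt_inv ;
  mpt_invK : cancel mpt_inv mpt_fun }.

Section Rank.
Context d (X : measurableType d) (R : realType) (mu : probability X R).

Definition mpt_zpow (T : invertible_mpt mu) (p : int) : X -> X :=
  match p with
  | Posz m => iter m T
  | Negz m => iter m.+1 (mpt_inv T)
  end.

Definition commuting n (U : 'I_n -> invertible_mpt mu) : Prop :=
  forall i k x, U i (U k x) = U k (U i x).

Definition dependent n (U : 'I_n -> invertible_mpt mu) (J : {set 'I_n}) : Prop :=
  exists p : 'I_n -> int, (exists2 k, k \in J & p k != 0) /\
    {ae mu, forall x, (\big[comp/idfun]_(k in J) mpt_zpow (U k) (p k)) x = x}.

Definition independent n (U : 'I_n -> invertible_mpt mu) (J : {set 'I_n}) : Prop :=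
  ~ dependent U J.

(* Repetitions in U are harmless: if U i = U k with i, k distinct in J, then J
   is dependent, so an independent J indexes #|J| distinct transformations. *)
Definition rank n (U : 'I_n -> invertible_mpt mu) : nat :=
  \max_(J : {set 'I_n} | `[< independent U J >]) #|J|.

End Rank.

Section LlogL.
Context (R : realType).

(* ln 0 = 0 here, so Phi m 0 = 0. *)
Definition Phi (m : nat) (t : R) : R := t * (1 + Num.max 0 (ln t ^+ m)).

Definition LlogL d (X : measurableType d) (mu : probability X R) (m : nat)
    (f : X -> R) : Prop :=
  measurable_fun setT f /\
  mu.-integrable setT
    (fun x => (if m == 0%N then f x else Phi m `|f x|)%:E).

End LlogL.

(* min_k s_k --> oo *)
Definition multi_oo n : set_system ('I_n -> nat) :=
  filter_from [set: nat] (fun N => [set s | forall k, (N <= s k)%N]).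

Arguments multi_oo : clear implicits.

Global Instance multi_oo_filter n : ProperFilter (multi_oo n).
Proof.
apply: filter_from_proper; last by move=> N _; exists (fun=> N) => k /=.
apply: filter_from_filter; first by exists 0%N.
move=> M N _ _; exists (maxn M N) => // s /= sMN.
by split=> k /=; apply: leq_trans (sMN k); rewrite ?leq_maxl ?leq_maxr.
Qed.

(* The index j runs over all tuples with 0 <= j k < s k for every k. *)
Definition mean d (X : measurableType d) (R : realType) (mu : probability X R)
    n (U : 'I_n -> invertible_mpt mu) (f : X -> R) (s : 'I_n -> nat) (x : X) : R :=
  (\prod_(k < n) (s k)%:R)^-1 *
  \sum_(j : {dffun forall k : 'I_n, 'I_(s k)})
    f ((\big[comp/idfun]_(k < n) iter (j k) (U k)) x).

(* Main.v *)
Require Import Defs.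
From mathcomp Require Import all_boot all_order all_algebra.
From mathcomp Require Import all_classical all_reals all_analysis.
From mathcomp Require Import measurable_realfun zify ring lra.
Import Order.TTheory GRing.Theory Num.Theory.
Import numFieldNormedType.Exports.
Local Open Scope classical_set_scope.
Local Open Scope ring_scope.

(* The truncation of f at height N is bounded, and for bounded functions
   multiparameter convergence follows from Birkhoff's theorem by induction on n.
   It remains to show that the averages of the tail h_N = |f| 1_{|f| > N} tend
   to 0 with N, uniformly in s, almost everywhere.
   If the family is independent it has at most d members, the averages are
   bounded by an iterate of at most d one-parameter maximal functions of h_N,
   and each of them loses one logarithm: d - 1 iterates leave an integrable
   function, and the last one is of weak type (1,1).
   If the family satisfies a relation U^p = id, let k be the index with
   p_k <> 0 for which s_k is smallest.  Modulo the relation a power of U_k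
   equals one of finitely many powers of U_k followed by a translation by a
   vector whose entries are O(s_k), and which is nonzero only in directions b
   with s_b >= s_k.  So the average over s_k is absorbed by a bounded dilation
   of the box in the other directions, and U_k can be dropped from the family. *)

Set Implicit Arguments.
Unset Strict Implicit.
Unset Printing Implicit Defensive.

(** * The maximal ergodic inequality *)

Section OrbitSums.
Context d (X : measurableType d) (R : realType) (mu : probability X R).
Local Open Scope ereal_scope.
Implicit Types (T : X -> X) (g lam : X -> \bar R).

Lemma sume_const (s : nat) (c : \bar R) : 0 <= c ->
  \sum_(0 <= j < s) c = s%:R%:E * c.
Proof.
move=> c0; elim: s => [|s IH]; first by rewrite big_geq// mul0e.
by rewrite big_nat_recr//= IH -natr1 EFinD ge0_muleDl// mul1e.
Qed.

Definition orbit_sum T g (s : nat) (x : X) : \bar R :=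
  \sum_(0 <= j < s) g (iter j T x).

Lemma orbit_sum_ge0 T g s x : (forall y, 0 <= g y) -> 0 <= orbit_sum T g s x.
Proof. by move=> g0; apply: sume_ge0. Qed.

Lemma orbit_sumD T g s t x :
  orbit_sum T g (s + t) x = orbit_sum T g s x + orbit_sum T g t (iter s T x).
Proof.
rewrite /orbit_sum (big_cat_nat _ (n := s)) ?leq_addr//=; congr (_ + _).
rewrite -{1}(add0n s) big_addn addKn; apply: eq_bigr => j _.
by rewrite iterD.
Qed.

Lemma le_orbit_sum T g h s t x : (forall y, 0 <= h y) ->
  (forall y, g y <= h y) -> (s <= t)%N -> orbit_sum T g s x <= orbit_sum T h t x.
Proof.
move=> h0 gh st; rewrite -(subnKC st) orbit_sumD.
rewrite -[leLHS]adde0; apply: leeD; last exact: orbit_sum_ge0.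
by apply: lee_sum.
Qed.

Lemma measurable_iter T j : measurable_fun setT T -> measurable_fun setT (iter j T).
Proof.
move=> mT; elim: j => [|j IH]; first exact: measurable_id.
exact: (measurableT_comp mT IH).
Qed.

Lemma measurable_orbit_sum T g s : measurable_fun setT T ->
  measurable_fun setT g -> measurable_fun setT (orbit_sum T g s).
Proof.
move=> mT mg; apply: emeasurable_sum => j.
exact: (measurableT_comp mg (measurable_iter j mT)).
Qed.

Lemma measure_preserving_iter T j :
  measure_preserving mu T -> measure_preserving mu (iter j T).
Proof.
move=> [mT TE]; split; first exact: measurable_iter.
elim: j => [//|j IH] E mE.
rewrite -(TE E mE) -(IH (T @^-1` E))//.
by rewrite -[X in measurable X]setTI; exact: mT.
Qed.

Lemma integral_measure_preserving T g : measure_preserving mu T ->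
  measurable_fun setT g -> (forall y, 0 <= g y) ->
  \int[mu]_x g (T x) = \int[mu]_x g x.
Proof.
move=> [mT TE] mg g0.
have := ge0_integral_pushforward mT mu measurableT mg (fun y _ => g0 y).
rewrite preimage_setT => <-.
by apply: eq_measure_integral => A mA _; exact: TE.
Qed.

Lemma integral_orbit_sum T g s : measure_preserving mu T ->
  measurable_fun setT g -> (forall y, 0 <= g y) ->
  \int[mu]_x orbit_sum T g s x = s%:R%:E * \int[mu]_x g x.
Proof.
move=> mpT mg g0; rewrite ge0_integral_sum//; last first.
  by move=> j; apply: (measurableT_comp mg); apply: measurable_iter; case: mpT.
under eq_bigr do rewrite (integral_measure_preserving (measure_preserving_iter _ mpT))//.
by rewrite sume_const// integral_ge0.
Qed.


(** Walk along the orbit: outside [E] advance one step, inside [E] jump over a stretch on which the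
    sum of [g] beats that of the invariant [lam]. The last stretch may overrun [L] by at most
    [N]. *)
Lemma orbit_sum_covering T g lam (E : set X) N L x :
  (forall y, 0 <= g y) -> (forall y, 0 <= lam y) ->
  (forall y, lam (T y) = lam y) ->
  (forall y, E y -> exists2 s, (s < N)%N &
     s.+1%:R%:E * lam y <= orbit_sum T g s.+1 y) ->
  orbit_sum T (lam \_ E) L x <= orbit_sum T g (L + N) x.
Proof.
move=> g0 lam0 lamT EN; have [n] := ubnP L.
elim: n L x => // n IH [|L] x Ln.
  by rewrite [leLHS]/orbit_sum big_geq//; exact: orbit_sum_ge0.
have lamE0 y : 0 <= (lam \_ E) y by rewrite patchE; case: ifP.
have lamEle y : (lam \_ E) y <= lam y by rewrite patchE; case: ifP.
have [Ex|nEx] := pselect (E x); last first.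
  rewrite -add1n -addnA 2!orbit_sumD; apply: leeD; last exact: IH.
  rewrite /orbit_sum !big_nat1/= patchE memNset//.
have [s sN sx] := EN x Ex.
have lam_sum t : orbit_sum T lam t x = t%:R%:E * lam x.
  rewrite -sume_const//; apply: eq_bigr => j _.
  by elim: j => //= j; rewrite lamT.
have [Ls|sL] := leqP L.+1 s.+1.
  apply: (@le_trans _ _ (orbit_sum T lam s.+1 x)); first exact: le_orbit_sum.
  rewrite lam_sum; apply: le_trans sx _; apply: le_orbit_sum => //.
  by rewrite (leq_trans sN)// leq_addl.
rewrite -(subnKC (ltnW sL)) -addnA 2!orbit_sumD; apply: leeD; last first.
  by apply: IH; lia.
by apply: le_trans sx; rewrite -lam_sum; exact: le_orbit_sum.
Qed.

(** Divide by [L] and let it tend to infinity. *)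
Lemma le_of_natmul_le (a b : \bar R) (N : nat) : 0 <= a -> 0 <= b ->
  (forall L : nat, L%:R%:E * a <= (L + N)%:R%:E * b) -> a <= b.
Proof.
case: a b => [a| |] [b| |]//=; rewrite ?leey ?lee_fin// => a0 b0 H; last first.
  have := H 1%N; rewrite mul1e -EFinM leye_eq//.
rewrite leNgt; apply/negP => ba.
have ab0 : (0 < a - b)%R by rewrite subr_gt0.
(* This makes [L * (a - b)] exceed [N * b], against the hypothesis at [L]. *)
pose L := (Num.truncn (N%:R * b / (a - b))).+1.
have : (N%:R * b / (a - b) < L%:R)%R by exact: truncnS_gt.
rewrite ltr_pdivrMr// => H1.
have := H L; rewrite -!EFinM lee_fin natrD; lra.
Qed.

(* The covering bound, integrated, gives L * int_E lam <= (L + N) * int g. *)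
Lemma maximal_ergodic T g lam : measure_preserving mu T ->
  measurable_fun setT g -> measurable_fun setT lam ->
  (forall y, 0 <= g y) -> (forall y, 0 <= lam y) ->
  (forall y, lam (T y) = lam y) ->
  \int[mu]_(x in [set x | exists s, s.+1%:R%:E * lam x <= orbit_sum T g s.+1 x])
    lam x <= \int[mu]_x g x.
Proof.
move=> mpT mg mlam g0 lam0 lamT.
pose F s := [set x | s.+1%:R%:E * lam x <= orbit_sum T g s.+1 x].
have mT : measurable_fun setT T by case: mpT.
have mF s : measurable (F s).
  rewrite -[F s]setTI; apply: measurable_lee => //.
    exact: measurable_funeM.
  exact: measurable_orbit_sum.
(* [E N] collects the points with a good stretch of length at most [N], as the covering requires;
   monotone convergence then removes the bound. *)
pose E N := \big[setU/set0]_(s < N) F s.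
have mE N : measurable (E N) by exact: bigsetU_measurable.
have EF N x : E N x -> exists2 s, (s < N)%N & F s x.
  by rewrite /E -bigcup_mkord => -[s sN Fsx]; exists s.
have -> : [set x | exists s, F s x] = \bigcup_N E N.
  apply/seteqP; split => [x [s Fsx]|x [N _ /EF[s _ Fsx]]]; last by exists s.
  by exists s.+1 => //; rewrite /E -bigcup_mkord; exists s => /=.
have EN N : \int[mu]_(x in E N) lam x <= \int[mu]_x g x.
  rewrite integral_mkcond.
  have lamE0 y : 0 <= (lam \_ (E N)) y by rewrite patchE; case: ifP.
  have mlamE : measurable_fun setT (lam \_ (E N)).
    apply/(measurable_restrictT _ _).1 => //.
    exact: measurable_funTS.
  apply: (@le_of_natmul_le _ _ N); try exact: integral_ge0.
  move=> L; rewrite -!(@integral_orbit_sum T)//.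
  apply: ge0_le_integral => //.
  - by move=> x _; exact: orbit_sum_ge0.
  - exact: measurable_orbit_sum.
  - exact: measurable_orbit_sum.
  - by move=> x _; apply: orbit_sum_covering => // y; exact: EF.
have ndE : {homo E : m n / (m <= n)%N >-> (m <= n)%O}.
  by move=> m n mn; apply/subsetPset; exact: subset_bigsetU.
have cvgE := @ge0_nondecreasing_set_cvg_integral _ _ _ E lam mu ndE mE
  (fun i => measurable_funTS mlam) (fun i x _ => lam0 x).
rewrite -(cvg_lim _ cvgE)//; apply: lime_le; last exact: nearW.
by apply/cvg_ex; eexists; exact: cvgE.
Qed.

End OrbitSums.

(** * Maximal functions and their weak type inequalities *)

Section MaximalFunction.
Context d (X : measurableType d) (R : realType) (mu : probability X R).
Local Open Scope ereal_scope.
Implicit Types (T : X -> X) (g lam : X -> \bar R).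

Definition maxfun T g (x : X) : \bar R :=
  ereal_sup (range (fun s => s.+1%:R^-1%:E * orbit_sum T g s.+1 x)).

Lemma orbit_sum_le_maxfun T g s x :
  orbit_sum T g s.+1 x <= s.+1%:R%:E * maxfun T g x.
Proof.
rewrite -lee_pdivrMl//.
by apply: ereal_sup_ubound; exists s.
Qed.

Lemma maxfun_ge0 T g x : (forall y, 0 <= g y) -> 0 <= maxfun T g x.
Proof.
move=> g0; apply: le_ereal_sup_tmp; eexists; first by exists 0%N.
by rewrite mule_ge0// ?lee_fin// orbit_sum_ge0.
Qed.

Lemma measurable_maxfun T g : measurable_fun setT T ->
  measurable_fun setT g -> measurable_fun setT (maxfun T g).
Proof.
move=> mT mg.
pose u s x := s.+1%:R^-1%:E * orbit_sum T g s.+1 x.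
have -> : maxfun T g = fun x => esups (u ^~ x) 0%N.
  by apply/funext => x; congr (ereal_sup _); apply/seteqP; split => y [s _ <-]; exists s.
apply: measurable_fun_esups => s; apply: measurable_funeM.
exact: measurable_orbit_sum.
Qed.

Lemma le_maxfun T g h x : (forall y, 0 <= h y) -> (forall y, g y <= h y) ->
  maxfun T g x <= maxfun T h x.
Proof.
move=> h0 gh; apply: ge_ereal_sup => _ [s _ <-].
apply: le_ereal_sup_tmp; eexists; first by exists s.
by rewrite lee_pmul2l// ?lte_fin//; apply: le_orbit_sum.
Qed.

Lemma maxfun_weak_type T g (c : R) : measure_preserving mu T ->
  measurable_fun setT g -> (forall y, 0 <= g y) -> (0 < c)%R ->
  c%:E * mu [set x | c%:E < maxfun T g x] <= \int[mu]_x g x.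
Proof.
move=> mpT mg g0 c0.
have mT : measurable_fun setT T by case: mpT.
pose lam := cst c%:E : X -> \bar R.
have := @maximal_ergodic _ _ _ mu T g lam mpT mg (measurable_cst _) g0 _ _.
move=> /(_ (fun=> ltW c0) (fun=> erefl)); apply: le_trans.
set E := [set x | exists s, _].
have mE : measurable E.
  rewrite (_ : E = \bigcup_s (setT `&` [set x | s.+1%:R%:E * lam x <= orbit_sum T g s.+1 x])).
    apply: bigcup_measurable => s _; apply: measurable_lee => //.
    exact: measurable_orbit_sum.
  by apply/seteqP; split => [x [s sx]|x [s _ [_ sx]]]; exists s.
rewrite integral_cst// lee_pmul2l ?lte_fin//.
apply: le_measure; rewrite ?inE//.
  rewrite -[X in measurable X]setTI; apply: emeasurable_fun_o_infty => //.
  exact: measurable_maxfun.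
move=> x /= /ereal_sup_gt[_ [s _ <-]] cs; exists s.
by apply/ltW; rewrite -lte_pdivlMl.
Qed.

(** The part of [g] below height [c] adds at most [c] to every average, so an average of [g] above
    [2 * c] forces one above [c] for the restriction of [g] to the set where [c < g]. *)
Lemma maxfun_weak_type_level T g (c : R) : measure_preserving mu T ->
  measurable_fun setT g -> (forall y, 0 <= g y) -> (0 < c)%R ->
  c%:E * mu [set x | (2 * c)%:E < maxfun T g x] <=
  \int[mu]_(x in [set x | c%:E < g x]) g x.
Proof.
move=> mpT mg g0 c0.
have mT : measurable_fun setT T by case: mpT.
set E := [set x | c%:E < g x].
have mE : measurable E.
  by rewrite -[X in measurable X]setTI; exact: emeasurable_fun_o_infty.
rewrite integral_mkcond.
have mgE : measurable_fun setT (g \_ E).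
  by apply/(measurable_restrictT _ _).1 => //; exact: measurable_funTS.
have gE0 y : 0 <= (g \_ E) y by rewrite patchE; case: ifP.
apply: le_trans (@maxfun_weak_type T (g \_ E) c mpT mgE gE0 c0).
rewrite lee_pmul2l ?lte_fin//; apply: le_measure; rewrite ?inE.
- rewrite -[X in measurable X]setTI; apply: emeasurable_fun_o_infty => //.
  exact: measurable_maxfun.
- rewrite -[X in measurable X]setTI; apply: emeasurable_fun_o_infty => //.
  exact: measurable_maxfun.
move=> x /= /ereal_sup_gt[_ [s _ <-]] cs.
apply: lt_le_trans (ereal_sup_ubound _); last by exists s.
rewrite lte_pdivlMl//; move: cs; rewrite lte_pdivlMl// => cs.
have : orbit_sum T g s.+1 x <= orbit_sum T (g \_ E) s.+1 x + (s.+1%:R * c)%:E.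
  rewrite EFinM -sume_const; last by rewrite lee_fin ltW.
  rewrite /orbit_sum -big_split/=.
  apply: lee_sum => j _; rewrite patchE; case: ifPn => [_|/negP].
    by rewrite leeDl// lee_fin ltW.
  by rewrite inE/= add0e => /negP; rewrite -leNgt.
move=> /(lt_le_trans cs); rewrite (_ : _ * (2 * c)%:E = (s.+1%:R * c)%:E + (s.+1%:R * c)%:E); last first.
  by rewrite -EFinM -EFinD; congr EFin; ring.
by rewrite lteD2rE.
Qed.

Lemma mpt_inv_measure_preserving (T : invertible_mpt mu) :
  measure_preserving mu (mpt_inv T).
Proof.
have [mT TE] := mpt_funP T.
split; first exact: mpt_inv_measurable.
move=> E mE; rewrite -TE; last first.
  by rewrite -[X in measurable X]setTI; exact: (mpt_inv_measurable T).
by congr (mu _); apply/seteqP; split => x /=; rewrite mpt_funK.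
Qed.

(** The backward orbit enters because a dependence relation translates boxes by vectors of either
    sign. *)
Definition maxfun2 (T : invertible_mpt mu) g (x : X) : \bar R :=
  maxfun T g x + maxfun (mpt_inv T) g x.

Lemma maxfun2_ge0 (T : invertible_mpt mu) g x :
  (forall y, 0 <= g y) -> 0 <= maxfun2 T g x.
Proof. by move=> g0; rewrite adde_ge0// maxfun_ge0. Qed.

Lemma measurable_maxfun2 (T : invertible_mpt mu) g :
  measurable_fun setT g -> measurable_fun setT (maxfun2 T g).
Proof.
move=> mg; apply: emeasurable_funD; apply: measurable_maxfun => //.
  by case: (mpt_funP T).
exact: mpt_inv_measurable.
Qed.

Lemma le_maxfun2 (T : invertible_mpt mu) g h x :
  (forall y, 0 <= h y) -> (forall y, g y <= h y) ->
  maxfun2 T g x <= maxfun2 T h x.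
Proof. by move=> h0 gh; apply: leeD; exact: le_maxfun. Qed.

(** If the sum exceeds [4 * c], one of its two terms exceeds [2 * c]; the factor 2 counts the
    terms. *)
Lemma maxfun2_weak_type (T : invertible_mpt mu) g (c : R) :
  measurable_fun setT g -> (forall y, 0 <= g y) -> (0 < c)%R ->
  c%:E * mu [set x | (4 * c)%:E < maxfun2 T g x] <=
  2%:E * \int[mu]_(x in [set x | c%:E < g x]) g x.
Proof.
move=> mg g0 c0.
have mT := mpt_funP T; have mV := mpt_inv_measure_preserving T.
have m1 S : measure_preserving mu S ->
    measurable [set x | (2 * c)%:E < maxfun S g x].
  move=> [mS _]; rewrite -[X in measurable X]setTI.
  by apply: emeasurable_fun_o_infty => //; exact: measurable_maxfun.
apply: (@le_trans _ _ (c%:E * mu ([set x | (2 * c)%:E < maxfun T g x] `|`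
    [set x | (2 * c)%:E < maxfun (mpt_inv T) g x]))).
  rewrite lee_pmul2l ?lte_fin//; apply: le_measure; rewrite ?inE.
  - rewrite -[X in measurable X]setTI; apply: emeasurable_fun_o_infty => //.
    exact: measurable_maxfun2.
  - by apply: measurableU; exact: m1.
  move=> x /=; apply: contraPP => /not_orP[/negP + /negP].
  rewrite -!leNgt => a b; apply/negP; rewrite -leNgt.
  by rewrite (_ : 4 * c = 2 * c + 2 * c)%R ?EFinD ?leeD//; ring.
have i0 : 0 <= \int[mu]_(x in [set x | c%:E < g x]) g x by exact: integral_ge0.
rewrite (EFinD 1 1) ge0_muleDl// mul1e; apply: le_trans (leeD _ _); last 2 first.
- exact: (maxfun_weak_type_level mT mg g0 c0).
- exact: (maxfun_weak_type_level mV mg g0 c0).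
rewrite -ge0_muleDr ?measure_ge0// lee_pmul2l ?lte_fin//.
by apply: measureU2; exact: m1.
Qed.

End MaximalFunction.

(** * Logarithmic Orlicz classes through dyadic level sets *)

Section Levels.
Context d (X : measurableType d) (R : realType) (mu : probability X R).
Local Open Scope ereal_scope.
Implicit Types g : X -> \bar R.

(* A discrete form of [int g (log+ g)^m < +oo].  The free scale c in log_levels
   absorbs the constants of the weak type inequality. *)
Definition level_sum (m : nat) (c : R) g : \bar R :=
  \sum_(0 <= k <oo) (k.+1 ^ m * 2 ^ k)%:R%:E * mu [set x | (c * 2 ^+ k)%:E < g x].

Definition log_levels m g := exists2 c : R, (0 < c)%R & level_sum m c g < +oo.

Lemma measurable_level g (c : R) : measurable_fun setT g ->
  measurable [set x | c%:E < g x].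
Proof.
by move=> mg; rewrite -[X in measurable X]setTI; exact: emeasurable_fun_o_infty.
Qed.

Lemma level_term_ge0 m c g k :
  0 <= (k.+1 ^ m * 2 ^ k)%:R%:E * mu [set x | (c * 2 ^+ k)%:E < g x].
Proof. by rewrite mule_ge0 ?measure_ge0 ?lee_fin. Qed.

Lemma nneseries_ge_term (u : nat -> \bar R) k : (forall j, 0 <= u j) ->
  u k <= \sum_(0 <= j <oo) u j.
Proof.
move=> u0; apply: (@le_trans _ _ (\sum_(0 <= j < k.+1) u j)); last first.
  exact: nneseries_lim_ge.
by rewrite big_nat_recr//= leeDr// sume_ge0.
Qed.

(* Either y lies in some dyadic block [c 2^j, c 2^(j+1)], or y = +oo. *)
Lemma dyadic_bound (y : \bar R) (c : R) k : (0 < c)%R -> (c * 2 ^+ k)%:E < y ->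
  y <= \sum_(0 <= j <oo)
    (((k <= j)%N && ((c * 2 ^+ j)%:E < y)%E)%:R * (c * 2 ^+ j.+1))%:E.
Proof.
move=> c0 ky; pose u j : \bar R :=
  (((k <= j)%N && ((c * 2 ^+ j)%:E < y)%E)%:R * (c * 2 ^+ j.+1))%:E.
have u0 j : 0 <= u j by rewrite lee_fin !mulr_ge0// ?ltW// exprn_ge0.
have [[j /and3P[kj jy yj]]|nex] := pselect (exists j,
    [&& (k <= j)%N, ((c * 2 ^+ j)%:E < y)%E & (y <= (c * 2 ^+ j.+1)%:E)%E]).
  by apply: le_trans yj (le_trans _ (nneseries_ge_term j u0)); rewrite /u kj jy mul1r.
have all j : (c * 2 ^+ (k + j))%:E < y.
  elim: j => [|j IH]; first by rewrite addn0.
  rewrite ltNge; apply/negP => yj; apply: nex; exists (k + j)%N.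
  by rewrite leq_addr IH -addnS.
(* Every level from [k] on is exceeded, so a single late term already passes any given [A]. *)
rewrite (_ : \sum_(0 <= j <oo) _ = +oo) ?leey//.
rewrite -/(\sum_(0 <= j <oo) u j); apply/eqyP => A A0; pose j := (Num.truncn (A / c)).+1.
apply: (@le_trans _ _ (u (k + j)%N)); last exact: nneseries_ge_term.
rewrite /u leq_addr all mul1r lee_fin mulrC -ler_pdivrMr//.
apply: (@le_trans _ _ j%:R); first by apply/ltW; exact: truncnS_gt.
rewrite -natrX ler_nat; apply: leq_trans (ltnW (@ltn_expl 2 j isT)) _.
by rewrite leq_exp2l// leqW// leq_addl.
Qed.

(** Apply [dyadic_bound] at each point and exchange sum and integral. *)
Lemma integral_above_le g (c : R) k : measurable_fun setT g ->
  (forall y, 0 <= g y) -> (0 < c)%R ->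
  \int[mu]_(x in [set x | (c * 2 ^+ k)%:E < g x]) g x <=
  \sum_(0 <= j <oo) ((k <= j)%N%:R * (c * 2 ^+ j.+1))%:E *
     mu [set x | (c * 2 ^+ j)%:E < g x].
Proof.
move=> mg g0 c0.
pose E j := [set x | (c * 2 ^+ j)%:E < g x].
have mE j : measurable (E j) by exact: measurable_level.
pose w j : R := ((k <= j)%N%:R * (c * 2 ^+ j.+1))%R.
have w0 j : (0 <= w j)%R by rewrite !mulr_ge0// ?ltW// exprn_ge0.
have -> : \sum_(0 <= j <oo) (w j)%:E * mu (E j) =
    \int[mu]_x \sum_(0 <= j <oo) (w j)%:E * (\1_(E j) x)%:E.
  rewrite integral_nneseries//; last 2 first.
  - by move=> j; apply: measurable_funeM; apply/measurable_EFinP.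
  - by move=> j x _; rewrite mule_ge0 ?lee_fin.
  apply: eq_eseriesr => j _.
  rewrite ge0_integralZl ?lee_fin//; last by apply/measurable_EFinP.
  by rewrite integral_indic// setIT.
rewrite -/(E k) [leLHS]integral_mkcond; apply: ge0_le_integral => //.
- by move=> x _; rewrite patchE; case: ifP.
- by apply/(measurable_restrictT _ _).1 => //; exact: measurable_funTS.
- apply: ge0_emeasurable_sum => j *.
    by rewrite mule_ge0 ?lee_fin.
  by apply: measurable_funeM; apply/measurable_EFinP.
move=> x _; rewrite patchE; case: ifPn => [|_]; last first.
  by apply: nneseries_ge0 => j _ _; rewrite mule_ge0 ?lee_fin.
rewrite inE => kx; apply: le_trans (dyadic_bound c0 kx) _.
apply: lee_nneseries => [j _ _|j _].
  by rewrite lee_fin !mulr_ge0// ?ltW// exprn_ge0.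
have Ex : (x \in E j) = ((c * 2 ^+ j)%:E < g x)%E by apply/idP/idP; rewrite inE.
by rewrite -EFinM lee_fin /w indicE Ex -mulnb natrM mulrAC.
Qed.

(** Bound [g] by [c] plus its restriction to [c < g]. The constant has finite integral, and
    [integral_above_le] at level 0 bounds the rest by [2 * c] times the level sum. *)
Lemma log_levels_integrable g : measurable_fun setT g ->
  (forall y, 0 <= g y) -> log_levels 0 g -> \int[mu]_x g x < +oo.
Proof.
move=> mg g0 [c c0 lev].
have mE : measurable [set x | c%:E < g x] by exact: measurable_level.
apply: (@le_lt_trans _ _ (\int[mu]_x (c%:E + (g \_ [set x | c%:E < g x]) x))).
  apply: ge0_le_integral => //.
  - apply: emeasurable_funD => //.
    by apply/(measurable_restrictT _ _).1 => //; exact: measurable_funTS.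
  move=> x _; rewrite patchE; case: ifPn => [_|/negP].
    by rewrite leeDr// lee_fin ltW.
  by rewrite inE/= adde0 => /negP; rewrite -leNgt.
rewrite ge0_integralD//; last 3 first.
- by move=> x _; rewrite lee_fin ltW.
- by move=> x _; rewrite patchE; case: ifP.
- by apply/(measurable_restrictT _ _).1 => //; exact: measurable_funTS.
rewrite -integral_mkcond integral_cst//= lte_add_pinfty//.
  apply: (@le_lt_trans _ _ c%:E); last by rewrite ltry.
  by rewrite -[leRHS]mule1 lee_pmul2l ?lte_fin// probability_le1.
have := @integral_above_le g c 0 mg g0 c0; rewrite expr0 mulr1.
move=> /le_lt_trans; apply.
rewrite (_ : \sum_(0 <= j <oo) _ = (2 * c)%:E * level_sum 0 c g).
  by rewrite lte_mul_pinfty// lee_fin mulr_ge0// ltW.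
rewrite /level_sum -nneseriesZl; last by move=> k _; exact: level_term_ge0.
apply: eq_eseriesr => j _; rewrite muleA -EFinM; congr (_%:E * _).
by rewrite leq0n mul1r expn0 mul1n natrX exprS; ring.
Qed.

(* By the weak type inequality at every dyadic level and Tonelli, one power of
   the logarithm is lost: sum_(k <= j) (k+1)^m <= (j+1)^(m+1). *)
Lemma log_levels_maxfun2 (T : invertible_mpt mu) m g : measurable_fun setT g ->
  (forall y, 0 <= g y) -> log_levels m.+1 g -> log_levels m (maxfun2 T g).
Proof.
move=> mg g0 [c c0 lev]; exists (4 * c)%R; first by rewrite mulr_gt0.
pose a j := mu [set x | (c * 2 ^+ j)%:E < g x].
have a0 j : 0 <= a j by exact: measure_ge0.
(* The share of level [j] of [g] in the estimate for level [k] of the maximal function; the scale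
   [c] has cancelled. *)
pose b k j : \bar R := ((k.+1 ^ m)%:R * (k <= j)%N%:R * (2 * 2 ^+ j.+1))%:E * a j.
have b0 k j : 0 <= b k j.
  by rewrite mule_ge0// lee_fin !mulr_ge0// exprn_ge0.
apply: (@le_lt_trans _ _ (\sum_(0 <= k <oo) \sum_(0 <= j <oo) b k j)).
  apply: lee_nneseries => [k _ _|k _]; first exact: level_term_ge0.
  have ck0 : (0 < c * 2 ^+ k)%R by rewrite mulr_gt0// exprn_gt0.
  have := maxfun2_weak_type T mg g0 ck0; rewrite mulrA => W.
  have two0 : 0 <= 2%:E :> \bar R by rewrite lee_fin.
  have {}W := le_trans W (lee_wpmul2l two0 (integral_above_le k mg g0 c0)).
  (* This multiplier turns the left side of the weak type bound into the term [k] of the level sum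
     of [maxfun2 T g]. *)
  have kc0 : 0 <= ((k.+1 ^ m)%:R / c)%:E :> \bar R by rewrite lee_fin divr_ge0// ltW.
  have := lee_wpmul2l kc0 W.
  rewrite !muleA -!EFinM (_ : _ * (c * 2 ^+ k) = (k.+1 ^ m * 2 ^ k)%:R)%R; last first.
    by rewrite natrM !natrX; field; rewrite gt_eqF.
  move=> /le_trans; apply; rewrite -nneseriesZl; last first.
    by move=> j _; rewrite mule_ge0 ?lee_fin// !mulr_ge0// ?ltW// exprn_ge0.
  apply: lee_nneseries => [j _ _|j _].
    apply: mule_ge0; first by rewrite lee_fin !mulr_ge0// invr_ge0 ltW.
    apply: mule_ge0 => //; rewrite lee_fin mulr_ge0// mulr_ge0 ?exprn_ge0//.
    exact: ltW.
  rewrite !muleA -!EFinM /b; set u := (_ * _)%R; set v := (_ * (2 * _))%R.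
  suff -> : u = v by [].
  by rewrite /u /v; field; rewrite gt_eqF.
rewrite nneseries_interchange//.
(* One factor 2 is the weak type constant, the other comes from [2 ^+ j.+1]. *)
apply: (@le_lt_trans _ _ (4%:E * level_sum m.+1 c g)); last first.
  by rewrite lte_mul_pinfty.
rewrite /level_sum -nneseriesZl; last by move=> k _; exact: level_term_ge0.
apply: lee_nneseries => [j _ _|j _]; first exact: nneseries_ge0.
rewrite (nneseries_split 0 j.+1)// [X in _ + X]eseries0 ?adde0; last first.
  by move=> i /=; rewrite add0n => ji _; rewrite /b leqNgt ji mulr0 mul0r mul0e.
rewrite add0n; apply: (@le_trans _ _ (\sum_(0 <= k < j.+1)
    ((j.+1 ^ m)%:R * (2 * 2 ^+ j.+1))%:E * a j)).
  rewrite big_nat [leRHS]big_nat; apply: lee_sum => k /andP[_ kj].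
  rewrite /b lee_wpmul2r// lee_fin -ltnS kj mulr1.
  rewrite ler_wpM2r ?mulr_ge0 ?exprn_ge0// ler_nat.
  by case: m {lev b b0} => // m; rewrite leq_exp2r.
rewrite sume_const; last by rewrite mule_ge0// lee_fin !mulr_ge0// exprn_ge0.
rewrite !muleA -!EFinM; set u := (_ * _)%R; set v := (4 * _)%R.
suff -> : u = v by [].
by rewrite /u /v expnS !natrM !natrX !exprS; ring.
Qed.

(** At a scale above the bound every level set is empty. *)
Lemma log_levels_bounded m g (K : R) : (forall x, g x <= K%:E) -> log_levels m g.
Proof.
move=> gK; exists (`|K| + 1)%R; first by rewrite ltr_pwDr.
rewrite /level_sum eseries0// => k _ _.
rewrite (_ : [set x | _] = set0) ?measure0 ?mule0//.
apply/seteqP; split => // x /=; apply/negP; rewrite -leNgt.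
apply: le_trans (gK x) _; rewrite lee_fin.
apply: le_trans (ler_norm _) _; apply: (@le_trans _ _ (`|K| + 1)%R).
  by rewrite lerDl.
by rewrite ler_peMr ?addr_ge0// -natrX ler1n expn_gt0.
Qed.

Lemma le_log_levels m g h : measurable_fun setT g -> measurable_fun setT h ->
  (forall x, g x <= h x) -> log_levels m h -> log_levels m g.
Proof.
move=> mg mh gh [c c0 lev]; exists c => //; apply: le_lt_trans lev.
apply: lee_nneseries => [k _ _|k _]; first exact: level_term_ge0.
rewrite lee_wpmul2l ?lee_fin//; apply: le_measure; rewrite ?inE.
- exact: measurable_level.
- exact: measurable_level.
by move=> x /= /lt_le_trans; apply.
Qed.

End Levels.

(** * Comparison of level sums with the function [Phi] *)

Section LlogLLevels.
Context (R : realType).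

(** The sum is geometric, hence at most twice its last nonzero term, which is below [t]. *)
Lemma dyadic_sum_le (t : R) N : 0 <= t ->
  \sum_(0 <= k < N) (2 ^+ k < t)%R%:R * 2 ^+ k <= 2 * t.
Proof.
move=> t0; elim: N => [|N IH]; first by rewrite big_geq// mulr_ge0.
have [Nt|tN] := ltP (2 ^+ N) t; last first.
  by rewrite big_nat_recr//= ltNge tN mul0r addr0.
apply: (@le_trans _ _ (2 * 2 ^+ N)); last by rewrite ler_pM2l// ltW.
apply: (@le_trans _ _ (\sum_(0 <= k < N.+1) 2 ^+ k)).
  by apply: ler_sum => k _; rewrite ler_piMl ?exprn_ge0// lern1 leq_b1.
elim: N {IH Nt} => [|N IH]; first by rewrite big_nat1 expr0 mulr1 ler1n.
rewrite big_nat_recr//=; have E : 2 ^+ N.+1 = 2 * 2 ^+ N :> R := exprS _ _.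
lra.
Qed.

(** Serves to turn [k * ln 2 < ln t] into [k <= 2 * ln t]; it is [ln (1 + u) <= u] at
    [u = - 2^-1]. *)
Lemma half_le_ln2 : 2^-1 <= ln (2 : R).
Proof.
have : ln (1 + - 2^-1) <= - 2^-1 :> R by apply: le_ln1Dx; lra.
have -> : 1 + - 2^-1 = 2^-1 :> R by field.
by rewrite lnV ?posrE// lerN2.
Qed.

(** Only levels with [2 ^+ k < t] count. For them [k + 1 <= 1 + 2 * ln t], and the remaining
    geometric sum is at most [2 * t]. *)
Lemma level_sum_le_Phi m (t : R) N : 0 <= t ->
  \sum_(0 <= k < N) (2 ^+ k < t)%R%:R * (k.+1 ^ m * 2 ^ k)%:R <= 2 * 3 ^+ m * Phi m t.
Proof.
move=> t0; have [t1|t1] := leP t 1.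
  rewrite big1 => [|k _].
    rewrite !mulr_ge0 ?exprn_ge0// addr_ge0// le_max lexx//.
  by rewrite ltNge (le_trans t1) ?mul0r// exprn_ege1// ler1n.
have lnt0 : 0 <= ln t by rewrite ln_ge0// ltW.
apply: (@le_trans _ _ ((1 + 2 * ln t) ^+ m * (2 * t))).
  apply: le_trans (ler_wpM2l _ (dyadic_sum_le N t0)); last first.
    by rewrite exprn_ge0// addr_ge0// mulr_ge0.
  rewrite mulr_sumr; apply: ler_sum => k _.
  have [kt|_] := ltP (2 ^+ k) t; last by rewrite !mul0r mulr0.
  rewrite !mul1r natrM !natrX ler_wpM2r ?exprn_ge0// lerXn2r ?nnegrE//.
    by rewrite addr_ge0// mulr_ge0.
  rewrite -natr1 addrC lerD2l.
  have := kt; rewrite -ltr_ln ?posrE ?exprn_gt0 ?(lt_trans _ t1)//.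
  rewrite lnXn// -[ln 2 *+ k]mulr_natr => lnkt.
  have := ler_wpM2r (ler0n R k) half_le_ln2; lra.
rewrite (_ : _ * (2 * t) = 2 * t * (1 + 2 * ln t) ^+ m); last by ring.
rewrite /Phi [leRHS](_ : _ = 2 * t * (3 ^+ m * (1 + Num.max 0 (ln t ^+ m)))); last by ring.
rewrite ler_wpM2l ?mulr_ge0// max_r ?exprn_ge0//.
(* If [ln t <= 1], the base [1 + 2 * ln t] is at most 3 and the summand 1 in [Phi] suffices;
   otherwise the base is at most [3 * ln t] and the logarithmic summand does. *)
have [u1|u1] := leP (ln t) 1.
  apply: (@le_trans _ _ (3 ^+ m)).
    by rewrite lerXn2r ?nnegrE//; lra.
  by rewrite ler_peMr ?exprn_ge0// lerDl exprn_ge0.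
rewrite mulrDr mulr1 -exprMn -[leLHS]add0r lerD ?exprn_ge0//.
by rewrite lerXn2r ?nnegrE//; lra.
Qed.

End LlogLLevels.

(** * Decreasing null sequences under maximal functions *)

Section NullSequences.
Context d (X : measurableType d) (R : realType) (mu : probability X R).
Local Open Scope ereal_scope.
Implicit Types g : X -> \bar R.

(** Exchanging sum and integral reduces the claim to the pointwise bound [level_sum_le_Phi]. *)
Lemma LlogL_log_levels m (f : X -> R) : LlogL mu m f ->
  log_levels mu m (fun x => `|f x|%:E).
Proof.
move=> [mf intf].
have mPhi : mu.-integrable setT (fun x => (Phi m `|f x|)%:E).
  (* In order 0 the hypothesis is integrability of [f] itself, and [Phi 0 t = 2 * t]. *)
  case: m intf => //= intf.
  rewrite (_ : (fun _ => _) = fun x => 2%:E * `|(f x)%:E|); last first.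
    by apply/funext => x; rewrite /Phi expr0 max_r// EFinM muleC.
  by apply: integrableZl => //; exact: integrable_abse.
exists 1%R => //.
have m_ k : measurable [set x | (1 * 2 ^+ k)%:E < `|f x|%:E].
  by apply: measurable_level; apply/measurable_EFinP; exact: measurableT_comp.
rewrite /level_sum.
under eq_eseriesr => k _.
  rewrite -[X in mu X]setIT -integral_indic// -ge0_integralZl; last 4 first.
  - by [].
  - by apply/measurable_EFinP.
  - by [].
  - by rewrite lee_fin.
  over.
rewrite -integral_nneseries//; last first.
  by move=> k; apply: measurable_funeM; apply/measurable_EFinP.
have Phi0 x : (0 <= Phi m `|f x|)%R.
  by rewrite mulr_ge0// addr_ge0// le_max lexx.
apply: (@le_lt_trans _ _ (\int[mu]_x ((2 * 3 ^+ m)%:E * (Phi m `|f x|)%:E))).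
  apply: ge0_le_integral => //.
  - by move=> x _; apply: nneseries_ge0 => k _ _; rewrite mule_ge0 ?lee_fin.
  - apply: ge0_emeasurable_sum => k *; first by rewrite mule_ge0 ?lee_fin.
    by apply: measurable_funeM; apply/measurable_EFinP.
  - by apply: measurable_funeM; case/integrableP: mPhi.
  move=> x _; apply: lime_le.
    by apply: is_cvg_nneseries => k _ _; rewrite mule_ge0 ?lee_fin.
  apply: nearW => N; under eq_bigr do rewrite -EFinM.
  rewrite sumEFin -EFinM lee_fin; apply: le_trans (level_sum_le_Phi m N (normr_ge0 _)).
  apply: ler_sum => k _; rewrite mulrC indicE; set u := (x \in _).
  suff -> : u = (2 ^+ k < `|f x|)%R by [].
  by apply/idP/idP; rewrite /u inE/= mul1r lte_fin.
have C0 : 0 <= (2 * 3 ^+ m)%:E :> \bar R by rewrite lee_fin mulr_ge0// exprn_ge0.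
rewrite ge0_integralZl//; last 2 first.
- by have /integrableP[] := mPhi.
- by move=> x _; rewrite lee_fin.
rewrite lte_mul_pinfty//.
have /integrableP[_ fin] := mPhi.
rewrite (eq_integral (fun x => `|(Phi m `|f x|)%:E|))// => x _.
by rewrite gee0_abs ?lee_fin.
Qed.

(** By monotonicity the last clause amounts to convergence to 0 almost everywhere. Both truncation
    tails and the errors in Birkhoff's theorem take this form. *)
Definition null_seq (h : nat -> X -> \bar R) :=
  [/\ forall N, measurable_fun setT (h N), forall N x, 0 <= h N x,
      forall N x, h N.+1 x <= h N x &
      {ae mu, forall x, forall e : R, (0 < e)%R -> exists N, h N x <= e%:E}].

Lemma null_seq_le h M N x : null_seq h -> (M <= N)%N -> h N x <= h M x.
Proof.
move=> [_ _ dec _] /subnKC <-; elim: (N - M)%N => [|k IH]; first by rewrite addn0.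
by rewrite addnS (le_trans (dec _ _)).
Qed.

(** Dominated convergence with majorant [h 0]. *)
Lemma null_seq_integral h (e : R) : null_seq h -> \int[mu]_x h 0%N x < +oo ->
  (0 < e)%R -> exists N, \int[mu]_x h N x <= e%:E.
Proof.
move=> nh h0oo e0; have [mh h0 dec hae] := nh.
have inth0 : mu.-integrable setT (h 0%N).
  by apply/integrableP; split => //; under eq_integral do rewrite gee0_abs//.
have cvgh : {ae mu, forall x, setT x -> h n x @[n --> \oo] --> cst 0 x}.
  apply: filterS hae => x hx _.
  have := @ereal_nonincreasing_cvgn _ (h ^~ x) _.
  rewrite (_ : ereal_inf _ = 0).
    by apply => M N MN; exact: null_seq_le.
  apply/eqP; rewrite eq_le; apply/andP; split; last first.
    by apply: le_ereal_inf_tmp => _ [N _ <-].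
  apply/lee_addgt0Pr => r r0; rewrite add0e; have [N hN] := hx _ r0.
  by apply: le_trans hN; apply: ereal_inf_lbound; exists N.
have domh : {ae mu, forall x, forall n, setT x -> `|h n x| <= h 0%N x}.
  by apply: aeW => x n _; rewrite gee0_abs// null_seq_le.
have [_ _] := dominated_convergence measurableT mh (measurable_cst _) cvgh inth0 domh.
rewrite integral0 => /fine_cvgP[fin C].
move/cvgrPdist_le: C => /(_ e e0) ev.
have [N _ /(_ N (leqnn N))[finN /=]] := filterI fin ev.
rewrite sub0r normrN => evN; exists N.
rewrite -[leLHS](fineK finN) lee_fin; exact: le_trans (ler_norm _) evN.
Qed.

(** Where the maximal functions do not tend to 0, they all exceed some [1/(i+1)]. The weak type
    inequality bounds the measure of that set by a multiple of the integral of [h N], which tends to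
    0. *)
Lemma null_seq_maxfun2 h (T : invertible_mpt mu) : null_seq h ->
  \int[mu]_x h 0%N x < +oo -> null_seq (fun N => maxfun2 T (h N)).
Proof.
move=> nh h0oo; have [mh h0 dec hae] := nh; split.
- by move=> N; exact: measurable_maxfun2.
- by move=> N x; exact: maxfun2_ge0.
- by move=> N x; exact: le_maxfun2.
pose A i := \bigcap_N [set x | i.+1%:R^-1%:E < maxfun2 T (h N) x].
have mlev i N : measurable [set x | i.+1%:R^-1%:E < maxfun2 T (h N) x].
  by apply: measurable_level; exact: measurable_maxfun2.
have mA i : measurable (A i) by apply: bigcap_measurable => // N _.
have A0 i : mu (A i) = 0.
  apply/eqP; rewrite eq_le measure_ge0 andbT.
  apply/lee_addgt0Pr => e e0; rewrite add0e.
  (* Then [4 * c] is the level defining [A i], and an integral of at most [e * c / 2] gives measure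
     at most [e]. *)
  pose c : R := (4^-1 * i.+1%:R^-1)%R.
  have c0 : (0 < c)%R by rewrite mulr_gt0.
  have ec0 : (0 < e * c / 2)%R by rewrite !mulr_gt0.
  have [N hN] := null_seq_integral nh h0oo ec0.
  apply: (@le_trans _ _ (mu [set x | (4 * c)%:E < maxfun2 T (h N) x])).
    apply: le_measure; rewrite ?inE//.
      by apply: measurable_level; exact: measurable_maxfun2.
    by move=> x Ax; rewrite /= mulrA divff// mul1r; exact: Ax.
  rewrite -(lee_pmul2l (x := c%:E))//.
  apply: le_trans (maxfun2_weak_type T (mh N) (h0 N) c0) _.
  apply: (@le_trans _ _ (2%:E * (e * c / 2)%:E)); last first.
    by rewrite -!EFinM lee_fin; lra.
  rewrite lee_pmul2l//; apply: le_trans hN.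
  apply: ge0_subset_integral => //; exact: measurable_level.
have aeA : {ae mu, forall x, forall i, ~ A i x}.
  apply: ae_foralln => i; exists (A i); split; [exact: mA|exact: A0|].
  by move=> x /= /contrapT.
apply: filterS aeA => x nA e e0.
pose i := Num.truncn e^-1.
have ie : (i.+1%:R^-1 <= e)%R.
  by rewrite -[leRHS]invrK lef_pV2 ?posrE ?invr_gt0// ltW// truncnS_gt.
apply: contrapT => nex; apply: (nA i) => N _ /=; rewrite ltNge; apply/negP => Ni.
by apply: nex; exists N; rewrite (le_trans Ni)// lee_fin.
Qed.

Fixpoint maxfuns (Ts : seq (invertible_mpt mu)) g : X -> \bar R :=
  if Ts is T :: Ts' then maxfun2 T (maxfuns Ts' g) else g.

Lemma maxfuns_ge0 Ts g x : (forall y, 0 <= g y) -> 0 <= maxfuns Ts g x.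
Proof.
by move=> g0; elim: Ts x => //= T Ts IH x; exact: maxfun2_ge0.
Qed.

Lemma measurable_maxfuns Ts g :
  measurable_fun setT g -> measurable_fun setT (maxfuns Ts g).
Proof. by move=> mg; elim: Ts => //= T Ts IH; exact: measurable_maxfun2. Qed.

Lemma log_levels_maxfuns Ts m g : measurable_fun setT g ->
  (forall y, 0 <= g y) -> log_levels mu (m + size Ts) g ->
  log_levels mu m (maxfuns Ts g).
Proof.
move=> mg g0; elim: Ts m => [|T Ts IH] m /=; first by rewrite addn0.
rewrite addnS -addSn => /IH; apply: log_levels_maxfun2.
  exact: measurable_maxfuns.
by move=> y; exact: maxfuns_ge0.
Qed.

Lemma log_levels_exp m p g : (m <= p)%N -> log_levels mu p g -> log_levels mu m g.
Proof.
move=> mp [c c0 lev]; exists c => //; apply: le_lt_trans lev.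
apply: lee_nneseries => [k _ _|k _]; first exact: level_term_ge0.
rewrite lee_wpmul2r ?measure_ge0// lee_fin ler_nat leq_mul2r.
by rewrite leq_pexp2l ?orbT.
Qed.

(** Each maximal function costs one logarithm, but the outermost only needs an integrable argument;
    so order [m] pays for [m + 1] of them. *)
Lemma null_seq_maxfuns Ts m h : null_seq h -> log_levels mu m (h 0%N) ->
  (size Ts <= m.+1)%N -> null_seq (fun N => maxfuns Ts (h N)).
Proof.
move=> nh lev; have [mh h0 _ _] := nh.
elim: Ts => [//|T Ts IH] /=; rewrite ltnS => Tsm.
apply: null_seq_maxfun2; first by apply: IH; exact: leqW.
apply: log_levels_integrable; first exact: measurable_maxfuns.
  by move=> y; exact: maxfuns_ge0.
apply: log_levels_maxfuns => //.
by apply: log_levels_exp lev; rewrite add0n.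
Qed.

End NullSequences.

(** * Box sums and dependence relations *)

Section IntegerPowers.
Context d (X : measurableType d) (R : realType) (mu : probability X R).
Implicit Types T S : invertible_mpt mu.

Lemma mpt_zpowS T (p : int) x : mpt_zpow T (p + 1) x = T (mpt_zpow T p x).
Proof.
case: p => [m|[|m]].
- by rewrite -PoszD addn1.
- by rewrite (_ : Negz 0 + 1 = 0)//= mpt_invK.
- by rewrite (_ : Negz m.+1 + 1 = Negz m) ?[in RHS]/= ?mpt_invK//; lia.
Qed.

Lemma mpt_zpowP T (p : int) x : mpt_zpow T (p - 1) x = mpt_inv T (mpt_zpow T p x).
Proof. by rewrite -{2}(subrK 1 p) mpt_zpowS mpt_funK. Qed.

Lemma mpt_zpowD T (p q : int) x :
  mpt_zpow T (p + q) x = mpt_zpow T p (mpt_zpow T q x).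
Proof.
elim/int_rec: p => [|m IH|m IH]; first by rewrite add0r.
- by rewrite -addn1 PoszD addrAC !mpt_zpowS IH.
- by rewrite -addn1 PoszD opprD addrAC !mpt_zpowP IH.
Qed.

Lemma mpt_zpow_comm T (f : X -> X) p x : (forall y, f (T y) = T (f y)) ->
  f (mpt_zpow T p x) = mpt_zpow T p (f x).
Proof.
move=> fT; elim/int_rec: p => [//|m IH|m IH].
- by rewrite -addn1 PoszD !mpt_zpowS fT IH.
- rewrite -addn1 PoszD opprD !mpt_zpowP -IH.
  by apply: (can_inj (@mpt_funK _ _ _ _ T)); rewrite -fT !mpt_invK.
Qed.

End IntegerPowers.

Section Boxes.
Context d (X : measurableType d) (R : realType) (mu : probability X R).
Local Open Scope ereal_scope.
Implicit Types (T : invertible_mpt mu) (F : X -> \bar R).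

(* Two-sided sums, unlike those in mean: translating by c only enlarges the
   range, see zsum_shift. *)
Definition zsum T (s : nat) F (x : X) : \bar R :=
  \sum_(0 <= i < (s + s).+1) F (mpt_zpow T (i%:Z - s%:Z)%R x).

Lemma zsum_ge0 T s F x : (forall y, 0 <= F y) -> 0 <= zsum T s F x.
Proof. by move=> F0; apply: sume_ge0. Qed.

Lemma le_zsum T s F G x : (forall y, F y <= G y) -> zsum T s F x <= zsum T s G x.
Proof. by move=> FG; apply: lee_sum. Qed.

Lemma zsum_shift T (c : int) s t F x : (forall y, 0 <= F y) ->
  (s + `|c| <= t)%N -> zsum T s F (mpt_zpow T c x) <= zsum T t F x.
Proof.
move=> F0 sct; rewrite /zsum.
(* [k] is the place of the exponent [c - s] in the range from [-t] to [t]. *)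
have [k kE] : exists k : nat, (k%:Z = t%:Z - s%:Z + c)%R by exists (absz (t%:Z - s%:Z + c)%R); lia.
rewrite [leRHS](big_cat_nat _ (n := k))/=; [|lia|lia].
rewrite [X in _ + X](big_cat_nat _ (n := (s + s).+1 + k))/=; [|lia|lia].
rewrite -[leLHS]add0e; apply: leeD; first exact: sume_ge0.
rewrite -[leLHS]adde0; apply: leeD; last exact: sume_ge0.
rewrite -{1}(add0n k) big_addn addnK.
rewrite le_eqVlt; apply/orP; left; apply/eqP/eq_bigr => i _.
by rewrite -mpt_zpowD; congr (F (mpt_zpow _ _ _)); lia.
Qed.

(** Exponents from 0 to [s] form a forward orbit sum; the [s] negative ones form a backward sum once
    padded with exponent 0. *)
Lemma zsum_le_maxfun2 T s F x : (forall y, 0 <= F y) ->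
  zsum T s F x <= s.+1%:R%:E * maxfun2 T F x.
Proof.
move=> F0; have max0 (S : X -> X) : 0 <= maxfun S F x by exact: maxfun_ge0.
rewrite /zsum (big_cat_nat _ (n := s))/=; [|lia|lia].
rewrite ge0_muleDr//; rewrite addeC; apply: leeD.
  apply: le_trans (orbit_sum_le_maxfun _ _ _ _).
  rewrite -{1}(add0n s) big_addn -addSn addnK.
  rewrite le_eqVlt; apply/orP; left; apply/eqP/eq_bigr => i _.
  by congr (F _); rewrite PoszD addrK.
apply: le_trans (orbit_sum_le_maxfun _ _ _ _).
rewrite big_nat_rev/= add0n /orbit_sum big_nat_recl//=.
rewrite -[leLHS]add0e leeD// big_nat [leRHS]big_nat; apply: lee_sum => i /andP[_ si].
by rewrite (_ : (_ - _)%R = Negz i)//; lia.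
Qed.

Context (I : eqType) (U : I -> invertible_mpt mu).
Hypothesis Ucomm : forall i k x, U i (U k x) = U k (U i x).

Fixpoint boxsum (ks : seq I) (s : I -> nat) F : X -> \bar R :=
  if ks is k :: ks' then zsum (U k) (s k) (boxsum ks' s F) else F.

Fixpoint zact (ks : seq I) (p : I -> int) : X -> X :=
  if ks is k :: ks' then mpt_zpow (U k) (p k) \o zact ks' p else idfun.

Lemma boxsum_ge0 ks s F x : (forall y, 0 <= F y) -> 0 <= boxsum ks s F x.
Proof. by move=> F0; elim: ks x => //= k ks IH x; apply: zsum_ge0. Qed.

Lemma zpow_comm i k p q x : mpt_zpow (U i) p (mpt_zpow (U k) q x) =
  mpt_zpow (U k) q (mpt_zpow (U i) p x).
Proof.
apply: mpt_zpow_comm => y.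
by symmetry; apply: mpt_zpow_comm => z.
Qed.

Lemma zact_comm ks p k q x :
  zact ks p (mpt_zpow (U k) q x) = mpt_zpow (U k) q (zact ks p x).
Proof. by elim: ks => //= a ks ->; exact: zpow_comm. Qed.

Lemma zactD ks p q x :
  zact ks p (zact ks q x) = zact ks (fun k => (p k + q k)%R) x.
Proof.
by elim: ks => //= k ks IH; rewrite zact_comm -mpt_zpowD IH.
Qed.

Lemma eq_zact ks p q : {in ks, p =1 q} -> zact ks p =1 zact ks q.
Proof.
elim: ks => //= k ks IH pq x /=.
rewrite pq ?mem_head// IH// => i iks.
by rewrite pq// inE iks orbT.
Qed.

Lemma zact0 ks x : zact ks (fun=> 0%R) x = x.
Proof. by elim: ks. Qed.

Lemma zact_fixed ks p (m : int) x : zact ks p x = x ->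
  zact ks (fun k => (m * p k)%R) x = x.
Proof.
move=> px; elim/int_rec: m => [|m IH|m IH].
- by rewrite -[RHS](zact0 ks); apply: eq_zact => k _; rewrite mul0r.
- rewrite -[RHS]px -[in RHS]IH zactD; apply: eq_zact => k _.
  by rewrite -addn1 PoszD mulrDl mul1r addrC.
- rewrite -[in LHS]px zactD -[RHS]IH; apply: eq_zact => k _.
  by rewrite -addn1 PoszD opprD mulrBl mul1r subrK.
Qed.

Lemma zact_rem k ks p x : k \in ks ->
  zact ks p x = mpt_zpow (U k) (p k) (zact (rem k ks) p x).
Proof.
elim: ks => //= a ks IH; rewrite inE; case: eqVneq => [->//|ka /= kks].
by rewrite IH// zpow_comm.
Qed.

Lemma zsum_exchange i k s t F x :
  zsum (U i) s (zsum (U k) t F) x = zsum (U k) t (zsum (U i) s F) x.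
Proof.
rewrite /zsum exchange_big; apply: eq_bigr => a _; apply: eq_bigr => b _.
by rewrite zpow_comm.
Qed.

Lemma boxsum_rem k ks s F x : k \in ks ->
  boxsum ks s F x = zsum (U k) (s k) (boxsum (rem k ks) s F) x.
Proof.
elim: ks x => //= a ks IH x; rewrite inE; case: eqVneq => [->//|ka /= kks].
rewrite zsum_exchange.
by apply: eq_bigr => i _; rewrite IH.
Qed.

Lemma boxsum_shift ks c s t F x : (forall y, 0 <= F y) ->
  {in ks, forall k, (s k + `|c k| <= t k)%N} ->
  boxsum ks s F (zact ks c x) <= boxsum ks t F x.
Proof.
move=> F0; elim: ks x => //= k ks IH x sct.
have B0 y : 0 <= boxsum ks s F y by exact: boxsum_ge0.
apply: le_trans (zsum_shift _ _ B0 (sct k (mem_head _ _))) _.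
apply: lee_sum => i _; rewrite -zact_comm; apply: IH => j jks.
by apply: sct; rewrite inE jks orbT.
Qed.

(** The factor [s k + 1] stands for the [2 * s k + 1] exponents, from which it differs by a factor
    at most 2; it matches [zsum_le_maxfun2]. *)
Definition boxsize (ks : seq I) (s : I -> nat) : nat := \prod_(k <- ks) (s k).+1.

Lemma zsumZ T s (c : \bar R) F x : (forall y, 0 <= F y) ->
  zsum T s (fun y => c * F y) x = c * zsum T s F x.
Proof. by move=> F0; rewrite /zsum ge0_sume_distrr. Qed.

Lemma boxsum_le_maxfuns ks s F x : (forall y, 0 <= F y) ->
  boxsum ks s F x <= (boxsize ks s)%:R%:E * maxfuns (map U ks) F x.
Proof.
move=> F0; elim: ks x => [|k ks IH] x /=.
  by rewrite /boxsize big_nil mul1e.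
have M0 y : 0 <= maxfuns (map U ks) F y by exact: maxfuns_ge0.
apply: le_trans (le_zsum _ _ _ IH) _; rewrite zsumZ//.
rewrite /boxsize big_cons mulnC natrM EFinM -muleA lee_wpmul2l ?lee_fin//.
exact: zsum_le_maxfun2.
Qed.

End Boxes.

(** * Uniform smallness of box sums and elimination of an index *)

Section BoxNull.
Context d (X : measurableType d) (R : realType) (mu : probability X R).
Local Open Scope ereal_scope.

Lemma ae_shift (T : X -> X) (P : X -> Prop) : measure_preserving mu T ->
  {ae mu, forall x, P x} -> {ae mu, forall x, P (T x)}.
Proof.
move=> [mT TE] [A [mA A0 PA]]; exists (T @^-1` A); split.
- by rewrite -[X in measurable X]setTI; exact: mT.
- by rewrite TE.
by move=> x /= nP; apply: PA.
Qed.

Lemma ae_iter (T : X -> X) (P : X -> Prop) : measure_preserving mu T ->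
  {ae mu, forall x, P x} -> {ae mu, forall x, forall r, P (iter r T x)}.
Proof.
move=> mpT aeP; apply: ae_foralln => r.
exact: (ae_shift (measure_preserving_iter r mpT)).
Qed.

Context (I : finType) (U : I -> invertible_mpt mu).
Hypothesis Ucomm : forall i k x, U i (U k x) = U k (U i x).
Implicit Types (ks : seq I) (s t : I -> nat) (p : I -> int) (F : X -> \bar R).

(** The threshold for [N] may depend on [x] and [e] but not on [s]; eliminating an index dilates [s]
    and relies on this. *)
Definition box_null_at (ks : seq I) (h : nat -> X -> \bar R) (x : X) :=
  forall e : R, (0 < e)%R -> \forall N \near \oo, forall s : I -> nat,
    boxsum U ks s (h N) x <= (e * (boxsize ks s)%:R)%:E.

Definition box_null ks h := {ae mu, forall x, box_null_at ks h x}.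

Lemma box_null_maxfuns ks m h : null_seq mu h -> log_levels mu m (h 0%N) ->
  (size ks <= m.+1)%N -> box_null ks h.
Proof.
move=> nh lev ksm.
have nM : null_seq mu (fun N => maxfuns (map U ks) (h N)).
  by apply: null_seq_maxfuns nh lev _; rewrite size_map.
have [_ h0 _ _] := nh; have [_ _ _ aeM] := nM.
apply: filterS aeM => x Mx e /Mx[N0 MN0].
exists N0 => // N /= N0N s.
apply: le_trans (boxsum_le_maxfuns _ _ _ _ (h0 N)) _.
rewrite mulrC EFinM lee_wpmul2l ?lee_fin//.
exact: le_trans (null_seq_le x nM N0N) MN0.
Qed.

(** Factor by factor, [C * s k + 1 <= C * (s k + 1)]. *)
Lemma boxsize_scale (C : nat) ks s : (0 < C)%N ->
  (boxsize ks (fun k => C * s k) <= C ^ size ks * boxsize ks s)%N.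
Proof.
move=> C0; rewrite /boxsize; elim: ks => [|k ks IH]; first by rewrite !big_nil.
rewrite !big_cons/= expnS mulnACA leq_mul// mulnS -addn1 addnC leq_add2r//.
Qed.

Lemma boxsize_rem k ks s : k \in ks ->
  boxsize ks s = ((s k).+1 * boxsize (rem k ks) s)%N.
Proof. by move=> kks; rewrite /boxsize (big_rem k). Qed.

(* Writing z = m * p k + r with 0 <= r < |p k|, the relation turns U_k^z into
   U_k^r followed by a translation of the other coordinates by -m p. *)
Lemma zpow_relation ks p k (z : int) x : k \in ks -> p k != 0%R ->
  zact U ks p x = x ->
  mpt_zpow (U k) z x = zact U (rem k ks) (fun b => - (z %/ p k)%Z * p b)%R
    (iter (absz (z %% p k)%Z) (U k) x).
Proof.
move=> kks pk0 px; set m := (z %/ p k)%Z; set r := absz _.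
set y := iter r (U k) x.
have yE : y = mpt_zpow (U k) r x by [].
have py : zact U ks p y = y by rewrite yE zact_comm// px.
have rE : r = (z %% p k)%Z :> int by rewrite /r gez0_abs// modz_ge0.
rewrite {1}(divz_eq z (p k)) -/m -rE mpt_zpowD -yE.
have := zact_fixed Ucomm m py; rewrite (zact_rem Ucomm _ _ kks) => pmy.
rewrite -[in RHS]pmy zact_comm// zactD//; congr (mpt_zpow _ _ _).
rewrite -[LHS](zact0 U (rem k ks)); apply: eq_zact => b _.
by rewrite mulNr addNr.
Qed.

(** Each of the [2 * s k + 1] exponents of [U k] is traded for one of the [|p k|] starting points
    [iter r (U k) x] and a translation, which the larger box [t] absorbs. *)
Lemma boxsum_relation ks p k s t F x : uniq ks -> k \in ks -> p k != 0%R ->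
  zact U ks p x = x -> (forall y, 0 <= F y) ->
  {in rem k ks, forall b, (s b + s k * `|p b| <= t b)%N} ->
  forall B : \bar R,
  (forall r : 'I_(absz (p k)), boxsum U (rem k ks) t F (iter r (U k) x) <= B) ->
  boxsum U ks s F x <= (s k + s k).+1%:R%:E * B.
Proof.
move=> uks kks pk0 px F0 sst B rB.
have B0 : 0 <= B.
  have pk : (0 < absz (p k))%N by rewrite absz_gt0.
  by apply: le_trans (rB (Ordinal pk)); exact: boxsum_ge0.
rewrite (boxsum_rem Ucomm _ _ _ kks) /zsum -sume_const// big_nat [leRHS]big_nat.
apply: lee_sum => i /andP[_ i2s]; set z := (_ - _)%R.
rewrite (zpow_relation z kks pk0 px).
have rp : (absz (z %% p k)%Z < absz (p k))%N.
  by have := ltz_mod z pk0; have := modz_ge0 z pk0; lia.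
apply: le_trans (rB (Ordinal rp)) => /=.
apply: boxsum_shift => // b /sst; apply: leq_trans.
rewrite leq_add2l abszM leq_mul2r; apply/orP; right.
(* Dividing by a nonzero integer does not increase the absolute value, so the quotient is at most
   [s k] in absolute value. *)
have zE := divz_eq z (p k); have r0 := modz_ge0 z pk0; have rlt := ltz_mod z pk0.
have : (`|(z %/ p k)%Z| <= `|z|)%R by nia.
by rewrite /z; lia.
Qed.

(** The index to eliminate varies with [s], so smallness is assumed for every [k] with [p k != 0].
    Only finitely many pairs of [k] and remainder [r] occur, so one threshold for [N] serves them
    all. *)
Lemma box_null_dependent ks p h : uniq ks -> (forall N x, 0 <= h N x) ->
  (exists2 k, k \in ks & p k != 0%R) -> {ae mu, forall x, zact U ks p x = x} ->
  (forall k, k \in ks -> p k != 0%R -> box_null (rem k ks) h) ->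
  box_null ks h.
Proof.
move=> uks h0 [k0 k0ks pk0] aep IH.
have aeIH : {ae mu, forall x, forall k : {k | (k \in ks) && (p k != 0%R)},
    forall r, box_null_at (rem (val k) ks) h (iter r (U (val k)) x)}.
  apply: filter_forall => -[k /= /andP[kks pk]].
  by apply: ae_iter (IH k kks pk); exact: mpt_funP.
apply: filterS2 aep aeIH => x px Hx e e0.
(* As [C] exceeds every [|p b|], [s k <= s b] gives [s b + s k * |p b| <= C * s b]. *)
pose C := (\max_(b <- ks) absz (p b)).+1.
(* The 2 pays for [2 * s k + 1 <= 2 * (s k + 1)], the power of [C] for the dilation. *)
pose e' : R := (e / (2 * (C ^ size ks)%:R))%R.
have CR0 : (0 < (C ^ size ks)%:R :> R)%R by rewrite ltr0n expn_gt0.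
have e'0 : (0 < e')%R by rewrite divr_gt0// mulr_gt0.
have : \forall N \near \oo, forall k : {k | (k \in ks) && (p k != 0%R)},
    forall r : 'I_(absz (p (val k))), forall s : I -> nat,
    boxsum U (rem (val k) ks) s (h N) (iter r (U (val k)) x) <=
    (e' * (boxsize (rem (val k) ks) s)%:R)%:E.
  by apply: filter_forall => k; apply: filter_forall => r; exact: Hx.
apply: filterS => N HN s.
have : (k0 \in ks) && (p k0 != 0%R) by rewrite k0ks.
case/(@arg_minnP _ k0 (fun k => (k \in ks) && (p k != 0%R)) s) => k kP kmin.
have /andP[kks pk] := kP.
have := HN (exist _ k kP) => /= HNk.
pose t b := (C * s b)%N.
pose B : \bar R := (e' * (C ^ size ks * boxsize (rem k ks) s)%:R)%:E.
apply: (@le_trans _ _ ((s k + s k).+1%:R%:E * B)).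
  apply: (@boxsum_relation ks p k s t) => // [b /mem_rem bks|r].
    have [->|pb0] := eqVneq (p b) 0%R.
      by rewrite absz0 muln0 addn0 leq_pmull.
    rewrite /t mulSn leq_add2l mulnC leq_mul//; last first.
      by apply: kmin; rewrite bks.
    by apply: leq_bigmax_seq.
  apply: le_trans (HNk r t) _; rewrite lee_fin ler_pM2l// ler_nat.
  apply: leq_trans (boxsize_scale _ _ _) _ => //; rewrite leq_mul2r.
  by rewrite leq_pexp2l ?orbT// size_rem// leq_pred.
rewrite -EFinM lee_fin (boxsize_rem s kks).
rewrite [leRHS](_ : _ = (2 * (s k).+1)%:R * (e' * (C ^ size ks * boxsize (rem k ks) s)%:R))%R.
  by rewrite ler_wpM2r ?ler_nat//; [rewrite mulr_ge0// ltW|lia].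
by rewrite /e' !natrM; field; rewrite gt_eqF.
Qed.

End BoxNull.

(** * Birkhoff's theorem for bounded functions *)

Section Birkhoff.
Context d (X : measurableType d) (R : realType) (mu : probability X R).
Implicit Types (T : X -> X) (f : X -> R).

Definition avg T f (s : nat) (x : X) : R :=
  s%:R^-1 * \sum_(0 <= j < s) f (iter j T x).

Lemma measurable_avg T f s : measurable_fun setT T -> measurable_fun setT f ->
  measurable_fun setT (avg T f s).
Proof.
move=> mT mf; apply: measurable_funM => //; apply: measurable_sum => j.
exact: (measurableT_comp mf (measurable_iter j mT)).
Qed.

Lemma avg_affine T f (a b : R) s x :
  avg T (fun y => a * f y + b) s.+1 x = a * avg T f s.+1 x + b.
Proof.
rewrite /avg big_split/= -mulr_sumr sumr_const_nat subn0 mulrDr.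
by rewrite -[b *+ _]mulr_natl mulKf// mulrCA.
Qed.

Lemma orbit_sum_EFin T f s x :
  (orbit_sum T (EFin \o f) s.+1 x = (s.+1%:R * avg T f s.+1 x)%:E)%E.
Proof. by rewrite /orbit_sum sumEFin /avg mulVKf. Qed.

Section UnitInterval.
Context T f (mpT : measure_preserving mu T) (mf : measurable_fun setT f).
Hypothesis f01 : forall x, 0 <= f x <= 1.

Lemma avg_ge0 s x : 0 <= avg T f s x.
Proof.
by rewrite mulr_ge0// sumr_ge0// => j _; case/andP: (f01 (iter j T x)).
Qed.

Lemma avg_le1 s x : avg T f s.+1 x <= 1.
Proof.
rewrite /avg ler_pdivrMl// mulr1.
apply: (@le_trans _ _ (\sum_(0 <= j < s.+1) 1)).
  by apply: ler_sum => j _; case/andP: (f01 (iter j T x)).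
by rewrite sumr_const_nat subn0.
Qed.

(** The two sums differ only in one end term each, and both terms lie in [[0, 1]]. *)
Lemma avg_shift s x : `|avg T f s.+1 (T x) - avg T f s.+1 x| <= s.+1%:R^-1.
Proof.
rewrite /avg -mulrBr normrM ger0_norm// ler_piMr//.
rewrite [X in _ - X]big_nat_recl//= big_nat_recr//=.
under eq_bigr do rewrite -iterSr.
rewrite -iterSr addrC opprD addrA addrAC addrK.
have /andP[a0 a1] := f01 (iter s.+1 T x); have /andP[b0 b1] := f01 x.
by rewrite ler_norml; apply/andP; split; rewrite /= in a0 a1 *; lra.
Qed.

Definition limsup_avg (x : X) : \bar R := limn_esup (fun s => (avg T f s.+1 x)%:E).

Lemma limsup_avgE x : limsup_avg x =
  ereal_inf (range (esups (fun s => (avg T f s.+1 x)%:E))).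
Proof. by rewrite /limsup_avg limn_esup_lim; exact/cvg_lim/cvg_esups_inf. Qed.

Lemma limsup_avg_le_esups x N :
  (limsup_avg x <= esups (fun s => (avg T f s.+1 x)%:E) N)%E.
Proof. by rewrite limsup_avgE; apply: ereal_inf_lbound; exists N. Qed.

Lemma measurable_limsup_avg : measurable_fun setT limsup_avg.
Proof.
apply: measurable_fun_limn_esup => s; apply/measurable_EFinP.
by apply: measurable_avg => //; case: mpT.
Qed.

Lemma limsup_avg_ge0 x : (0 <= limsup_avg x)%E.
Proof.
rewrite limsup_avgE; apply: le_ereal_inf_tmp => _ [N _ <-].
apply: le_ereal_sup_tmp; eexists; first by exists N => /=.
by rewrite lee_fin avg_ge0.
Qed.

Lemma limsup_avg_le1 x : (limsup_avg x <= 1)%E.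
Proof.
apply: le_trans (limsup_avg_le_esups x 0) _.
by apply: ge_ereal_sup => _ [s _ <-]; rewrite lee_fin avg_le1.
Qed.

Lemma limsup_avg_fin x : limsup_avg x \is a fin_num.
Proof.
rewrite ge0_fin_numE ?limsup_avg_ge0//.
by rewrite (le_lt_trans (limsup_avg_le1 x))// ltry.
Qed.

Lemma limsup_avg_le_of_dist x y :
  (forall s, avg T f s.+1 x <= avg T f s.+1 y + s.+1%:R^-1) ->
  (limsup_avg x <= limsup_avg y)%E.
Proof.
move=> xy; apply/lee_addgt0Pr => e e0.
rewrite -leeBlDr// [leRHS]limsup_avgE; apply: le_ereal_inf_tmp => _ [n _ <-].
(* From this index on the error [1/(s+1)] is at most [e]. *)
pose N := maxn n (Num.truncn e^-1).
rewrite leeBlDr//; apply: le_trans (limsup_avg_le_esups x N) _.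
apply: ge_ereal_sup => _ [s /= Ns <-].
apply: (@le_trans _ _ ((avg T f s.+1 y)%:E + e%:E)%E); last first.
  rewrite leeD2r//; apply: ereal_sup_ubound; exists s => //=.
  by rewrite (leq_trans _ Ns)// leq_maxl.
rewrite -EFinD lee_fin; apply: le_trans (xy s) _; rewrite lerD2l.
rewrite -[leRHS]invrK lef_pV2 ?posrE ?invr_gt0//.
apply/ltW/(lt_le_trans (truncnS_gt _)); rewrite ler_nat ltnS.
by rewrite (leq_trans _ Ns)// leq_maxr.
Qed.

Lemma limsup_avg_invariant x : limsup_avg (T x) = limsup_avg x.
Proof.
apply/eqP; rewrite eq_le; apply/andP; split; apply: limsup_avg_le_of_dist => s;
  have := avg_shift s x; move: (s.+1%:R^-1) => c;
  rewrite ler_norml => /andP[h1 h2]; lra.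
Qed.

Lemma eventually_lt_limsup_avg x (e : R) : 0 < e ->
  \forall s \near \oo, avg T f s.+1 x < fine (limsup_avg x) + e.
Proof.
move=> e0; have : (limsup_avg x < limsup_avg x + e%:E)%E.
  by rewrite lteDl ?lte_fin// limsup_avg_fin.
rewrite {1}limsup_avgE => /ereal_inf_lt[_ [N _ <-]] supN.
exists N => // s /= Ns; rewrite -lte_fin EFinD fineK ?limsup_avg_fin//.
by apply: le_lt_trans supN; apply: ereal_sup_ubound; exists s.
Qed.

(* For theta < 1 every point x has an average above theta * limsup, so the
   maximal inequality applies with the exceptional set equal to the space. *)
Lemma integral_limsup_avg : (\int[mu]_x limsup_avg x <= \int[mu]_x (f x)%:E)%E.
Proof.
have L0 := limsup_avg_ge0; have mL := measurable_limsup_avg.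
have f0 x : (0 <= (f x)%:E)%E by rewrite lee_fin; case/andP: (f01 x).
apply/lee_mul01Pr; first exact: integral_ge0.
move=> t /andP[t0 t1]; rewrite -ge0_integralZl//; last by rewrite lee_fin ltW.
have tL0 x : (0 <= t%:E * limsup_avg x)%E by rewrite mule_ge0// lee_fin ltW.
have tLT x : (t%:E * limsup_avg (T x) = t%:E * limsup_avg x)%E.
  by rewrite limsup_avg_invariant.
have mtL : measurable_fun setT (fun x => t%:E * limsup_avg x)%E.
  exact: measurable_funeM.
have mf' : measurable_fun setT (EFin \o f) by exact/measurable_EFinP.
have := maximal_ergodic mpT mf' mtL f0 tL0 tLT.
rewrite (_ : [set x | _] = setT)//; apply/seteqP; split => // x _ /=.
suff [s ts] : exists s, (t%:E * limsup_avg x <= (avg T f s.+1 x)%:E)%E.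
  by exists s; rewrite orbit_sum_EFin EFinM lee_wpmul2l ?lee_fin.
(* Scaling by [t] strictly lowers only a positive limsup; if it is 0, the first average will do. *)
have [L00|Lpos] := eqVneq (limsup_avg x) 0%E.
  by exists 0%N; rewrite L00 mule0 lee_fin avg_ge0.
have : (t%:E * limsup_avg x < limsup_avg x)%E.
  rewrite -[ltRHS]mul1e lte_pmul2r ?limsup_avg_fin ?lte_fin//.
  by rewrite lt0e Lpos L0.
move=> /lt_le_trans/(_ (limsup_avg_le_esups x 0)).
by move=> /ereal_sup_gt[_ [s _ <-]] /ltW; exists s.
Qed.

End UnitInterval.

(** The averages of [f] and [1 - f] add up to 1, so their upper limits add up to at least 1
    everywhere, while the integrals of these limits add up to at most 1. Equality almost everywhere
    says that the upper and lower limits for [f] agree. *)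
Lemma birkhoff01 T f : measure_preserving mu T -> measurable_fun setT f ->
  (forall x, 0 <= f x <= 1) ->
  {ae mu, forall x, avg T f s.+1 x @[s --> \oo] --> fine (limsup_avg T f x)}.
Proof.
move=> mpT mf f01.
pose g x := -1 * f x + 1.
have g01 x : 0 <= g x <= 1 by rewrite /g; have /andP[] := f01 x; lra.
have mg : measurable_fun setT g.
  by apply: measurable_funD => //; exact: measurable_funM.
pose F := limsup_avg T f; pose G := limsup_avg T g.
have mF : measurable_fun setT F by exact: measurable_limsup_avg.
have mG : measurable_fun setT G by exact: measurable_limsup_avg.
have F0 x : (0 <= F x)%E by exact: limsup_avg_ge0.
have G0 x : (0 <= G x)%E by exact: limsup_avg_ge0.
have FG1 x : (1 <= F x + G x)%E.
  rewrite /F /G -(fineK (limsup_avg_fin T f01 x)) -(fineK (limsup_avg_fin T g01 x)).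
  rewrite -EFinD lee_fin; apply/ler_addgt0Pr => e e0.
  have e20 : 0 < e / 2 by rewrite divr_gt0.
  have [N _ /(_ N (leqnn N)) [/=]] := filterI
    (eventually_lt_limsup_avg T f01 x e20) (eventually_lt_limsup_avg T g01 x e20).
  by rewrite [avg T g _ _]avg_affine => uf ug; lra.
have intFG : (\int[mu]_x (F x + G x) <= 1)%E.
  rewrite ge0_integralD//.
  apply: le_trans (leeD (integral_limsup_avg mpT mf f01) (integral_limsup_avg mpT mg g01)) _.
  rewrite -ge0_integralD//; last 4 first.
  - by move=> x _; rewrite lee_fin; case/andP: (f01 x).
  - exact/measurable_EFinP.
  - by move=> x _; rewrite lee_fin; case/andP: (g01 x).
  - exact/measurable_EFinP.
  under eq_integral do rewrite -EFinD /g mulN1r addrA subrr add0r.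
  by rewrite integral_cst// mul1e probability_le1.
have aeFG : {ae mu, forall x, (F x + G x = 1)%E}.
  pose H x := (F x + G x - 1)%E.
  have H0 x : (0 <= H x)%E by rewrite /H leeBrDr// add0e.
  have mH : measurable_fun setT H by apply: emeasurable_funB => //; exact: emeasurable_funD.
  have : (\int[mu]_x `|H x| = 0)%E.
    rewrite (eq_integral H) => [|x _]; last by rewrite gee0_abs.
    have : (\int[mu]_x (H x + 1) <= 1)%E.
      by under eq_integral do rewrite /H subeK//.
    rewrite ge0_integralD// integral_cst// mul1e.
    rewrite [X in (_ + X)%E](_ : _ = 1%E); last exact: probability_setT.
    rewrite -leeBrDr// (@subee _ 1%E)// => I0; apply/eqP; rewrite eq_le I0 integral_ge0//.
  move/(ae_eq_integral_abs mu measurableT mH).1.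
  apply: filterS => x /(_ I) /= Hx.
  by rewrite -[LHS](@subeK _ _ 1%E)// -/(H x) Hx add0e.
apply: filterS aeFG => x FGx.
apply/cvgrPdist_lt => e e0.
near=> s.
have uf : avg T f s.+1 x < fine (F x) + e by near: s; exact: eventually_lt_limsup_avg.
have ug : avg T g s.+1 x < fine (G x) + e by near: s; exact: eventually_lt_limsup_avg.
have FG : fine (F x) + fine (G x) = 1.
  by rewrite -fineD ?limsup_avg_fin// FGx.
rewrite avg_affine in ug; rewrite -/(F x) ltr_norml; apply/andP; split; lra.
Unshelve. all: by end_near.
Qed.

(** Rescale [f] affinely into [[0, 1]]. The limit is again bounded and measurable, which lets the
    multiparameter induction continue with it. *)
Lemma birkhoff_bounded T f (K : R) : measure_preserving mu T ->
  measurable_fun setT f -> (forall x, `|f x| <= K) ->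
  exists g : X -> R, [/\ measurable_fun setT g,
    exists K' : R, forall x, `|g x| <= K' &
    {ae mu, forall x, avg T f s.+1 x @[s --> \oo] --> g x}].
Proof.
move=> mpT mf fK.
pose L := `|K| + 1.
have L0 : 0 < L by rewrite ltr_pwDr.
have fL x : - L <= f x <= L.
  by rewrite -ler_norml (le_trans (fK x))// (le_trans (ler_norm K))// lerDl.
pose h x := (2 * L)^-1 * f x + 2^-1.
have hE x : f x = 2 * L * h x - L by rewrite /h; field; rewrite gt_eqF.
have h01 x : 0 <= h x <= 1.
  have := fL x; rewrite hE => /andP[h1 h2].
  by apply/andP; split; rewrite -(ler_pM2l L0); lra.
have mh : measurable_fun setT h.
  by apply: measurable_funD => //; exact: measurable_funM.
exists (fun x => 2 * L * fine (limsup_avg T h x) - L); split.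
- apply: measurable_funB => //; apply: measurable_funM => //.
  apply: measurableT_comp => //; exact: measurable_limsup_avg.
- exists (3 * L) => x.
  have v0 : 0 <= fine (limsup_avg T h x) by rewrite fine_ge0// limsup_avg_ge0.
  have v1 : fine (limsup_avg T h x) <= 1.
    by rewrite -lee_fin fineK ?limsup_avg_fin// limsup_avg_le1.
  by rewrite ler_norml; apply/andP; split; nra.
apply: filterS (birkhoff01 mpT mh h01) => x hx.
have -> : (fun s => avg T f s.+1 x) = (fun s => 2 * L * avg T h s.+1 x - L).
  apply/funext => s; rewrite -avg_affine; congr (avg _ _ _ _).
  by apply/funext => y; rewrite hE.
by apply: cvgB (cvg_cst _); apply: cvgM (cvg_cst _) hx.
Qed.

End Birkhoff.

(** * Multiparameter means *)

Section MeanRecursion.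

(** Splitting a tuple into head and tail is injective between sets of equal cardinality, hence
    bijective. *)
Lemma dffun_split (V : nmodType) n (s : 'I_n.+1 -> nat)
    (Psi : 'I_(s ord0) -> {dffun forall k : 'I_n, 'I_(s (lift ord0 k))} -> V) :
  \sum_(j : {dffun forall k : 'I_n.+1, 'I_(s k)})
     Psi (j ord0) [ffun k : 'I_n => j (lift ord0 k)] =
  \sum_(j' : {dffun forall k : 'I_n, 'I_(s (lift ord0 k))})
     \sum_(i < s ord0) Psi i j'.
Proof.
pose phi (j : {dffun forall k : 'I_n.+1, 'I_(s k)}) :
    {dffun forall k : 'I_n, 'I_(s (lift ord0 k))} * 'I_(s ord0) :=
  ([ffun k : 'I_n => j (lift ord0 k)], j ord0).
have phi_inj : injective phi.
  move=> j l [/ffunP jl0 jl1]; apply/ffunP => k.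
  case: (unliftP ord0 k) => [k' ->|->//].
  by have := jl0 k'; rewrite !ffunE.
have phi_bij : bijective phi.
  apply: inj_card_bij phi_inj _.
  rewrite card_prod !card_dep_ffun !foldrE !big_image/= big_ord_recl/=.
  by rewrite mulnC.
rewrite pair_big/= (reindex phi)//=; exact: onW_bij.
Qed.

Context d (X : measurableType d) (R : realType) (mu : probability X R).

Definition tail_mpt n (U : 'I_n.+1 -> invertible_mpt mu) (k : 'I_n) :=
  U (lift ord0 k).

Definition tail_size n (s : 'I_n.+1 -> nat) (k : 'I_n) := s (lift ord0 k).

Lemma mean0 (U : 'I_0 -> invertible_mpt mu) f s x : mean U f s x = f x.
Proof.
rewrite /mean big_ord0 invr1 mul1r (eq_bigr (fun=> f x)) => [|j _]; last by rewrite big_ord0.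
rewrite sumr_const card_dep_ffun foldrE big_image/= big_ord0.
by [].
Qed.

Lemma sum_dffun_split n (U : 'I_n.+1 -> invertible_mpt mu) (f : X -> R) s x :
  \sum_(j : {dffun forall k : 'I_n.+1, 'I_(s k)})
    f ((\big[comp/idfun]_(k < n.+1) iter (j k) (U k)) x) =
  \sum_(j : {dffun forall k : 'I_n, 'I_(tail_size s k)}) \sum_(i < s ord0)
    f (iter i (U ord0) ((\big[comp/idfun]_(k < n) iter (j k) (tail_mpt U k)) x)).
Proof.
rewrite -(dffun_split (fun (i : 'I_(s ord0)) j => f (iter i (U ord0)
   ((\big[comp/idfun]_(k < n) iter (j k) (tail_mpt U k)) x)))).
apply: eq_bigr => j _; rewrite big_ord_recl/=; congr (f (iter _ _ _)).
by congr (_ x); apply: eq_bigr => k _; rewrite ffunE.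
Qed.

(** [U ord0] is applied last, so its average falls directly on [f]; Birkhoff's theorem is used on
    this inner average. *)
Lemma mean_inner n (U : 'I_n.+1 -> invertible_mpt mu) f s x :
  mean U f s x = mean (tail_mpt U) (avg (U ord0) f (s ord0)) (tail_size s) x.
Proof.
rewrite /mean big_ord_recl/= sum_dffun_split invfM -mulrA mulrCA; congr (_ * _).
rewrite mulr_sumr; apply: eq_bigr => j _.
by rewrite /avg big_mkord.
Qed.

Lemma iter_comm (A : Type) (T S : A -> A) a y :
  (forall z, T (S z) = S (T z)) -> T (iter a S y) = iter a S (T y).
Proof. by move=> TS; elim: a => //= a IH; rewrite TS IH. Qed.

(** Commutation moves [U ord0] next to [x], so that its sum is the outer one, as in [boxsum]. *)
Lemma mean_outer n (U : 'I_n.+1 -> invertible_mpt mu) f s x : commuting U ->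
  mean U f s x = (s ord0)%:R^-1 * \sum_(0 <= i < s ord0)
     mean (tail_mpt U) f (tail_size s) (iter i (U ord0) x).
Proof.
move=> hU; rewrite /mean big_ord_recl/= sum_dffun_split invfM -mulrA.
congr (_ * _); rewrite exchange_big/= big_mkord -mulr_sumr; congr (_ * _).
apply: eq_bigr => i _; apply: eq_bigr => j _; congr (f _).
elim/big_rec: (\big[_/_]_(_ < _) _) => //= k g _ <-.
by apply: iter_comm => z; symmetry; apply: iter_comm => y; exact: hU.
Qed.

Lemma ler_norm_mean n (U : 'I_n -> invertible_mpt mu) f s x :
  `|mean U f s x| <= mean U (fun y => `|f y|) s x.
Proof.
rewrite /mean normrM ger0_norm ?invr_ge0 ?prodr_ge0//.
by rewrite ler_wpM2l ?invr_ge0 ?prodr_ge0// ler_norm_sum.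
Qed.

Lemma meanB n (U : 'I_n -> invertible_mpt mu) f g s x :
  mean U (fun y => f y - g y) s x = mean U f s x - mean U g s x.
Proof. by rewrite /mean sumrB mulrBr. Qed.

Lemma boxsum_tail n (U : 'I_n.+1 -> invertible_mpt mu) ks s F x :
  boxsum U (map (lift ord0) ks) s F x = boxsum (tail_mpt U) ks (tail_size s) F x.
Proof. by elim: ks x => //= k ks IH x; apply: eq_bigr => i _; rewrite IH. Qed.

Lemma commuting_tail n (U : 'I_n.+1 -> invertible_mpt mu) :
  commuting U -> commuting (tail_mpt U).
Proof. by move=> hU i k x; exact: hU. Qed.

Lemma mean_le_boxsum n (U : 'I_n -> invertible_mpt mu) (f : X -> R)
    (F : X -> \bar R) s x : commuting U ->
  (forall y, 0 <= F y)%E -> (forall y, (f y)%:E <= F y)%E ->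
  ((mean U f s x)%:E <= (\prod_(k < n) (s k)%:R)^-1%:E * boxsum U (enum 'I_n) s F x)%E.
Proof.
move=> hU F0 fF; elim: n U s x hU => [|n IH] U s x hU.
  by rewrite mean0 enum_ord0/= big_ord0 invr1 mul1e.
rewrite mean_outer// big_ord_recl/= invfM !EFinM -muleA.
rewrite lee_wpmul2l ?lee_fin ?invr_ge0// -sumEFin enum_ordSl/= /zsum.
have B0 y : (0 <= boxsum U (map (lift ord0) (enum 'I_n)) s F y)%E by exact: boxsum_ge0.
have c0 : (0 <= (\prod_(k < n) (tail_size s k)%:R)^-1%:E :> \bar R)%E.
  by rewrite lee_fin invr_ge0 prodr_ge0.
apply: (@le_trans _ _ (\sum_(0 <= i < s ord0)
    (\prod_(k < n) (tail_size s k)%:R)^-1%:E *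
    boxsum (tail_mpt U) (enum 'I_n) (tail_size s) F (iter i (U ord0) x))%E).
  by apply: lee_sum => i _; apply: IH; exact: commuting_tail.
rewrite -ge0_sume_distrr => [|i _]; last exact: boxsum_ge0.
(* Of the exponents from [-s] to [s], keep those from 0 to [s - 1]. *)
rewrite lee_wpmul2l// [leRHS](big_cat_nat _ (n := s ord0))/=; [|lia|lia].
rewrite -[leLHS]add0e; apply: leeD; first exact: sume_ge0.
rewrite -{2}(add0n (s ord0)) big_addn -addSn addnK big_nat_recr//=.
rewrite -[leLHS]adde0; apply: leeD => //.
apply: lee_sum => i _; rewrite boxsum_tail PoszD addrK; exact: lexx.
Qed.

(* Here the box sum is over [-s_k, s_k] and the mean over [0, s_k), whence the
   factor 2^n. *)
Lemma mean_le_of_boxsum n (U : 'I_n -> invertible_mpt mu) (f : X -> R)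
    (F : X -> \bar R) (e : R) s x : commuting U ->
  (forall y, 0 <= F y)%E -> (forall y, (f y)%:E <= F y)%E ->
  (forall k, (0 < s k)%N) ->
  (boxsum U (enum 'I_n) s F x <= (e * (boxsize (enum 'I_n) s)%:R)%:E)%E ->
  0 <= e -> mean U f s x <= 2 ^+ n * e.
Proof.
move=> hU F0 fF s0 sF e0.
rewrite -lee_fin; apply: le_trans (mean_le_boxsum _ _ hU F0 fF) _.
have p0 : 0 < (\prod_(k < n) (s k)%:R) :> R by rewrite prodr_gt0// => k _; rewrite ltr0n.
rewrite lee_pdivrMl//; apply: le_trans sF _; rewrite -EFinM lee_fin.
rewrite mulrA [leRHS]mulrC ler_wpM2l// /boxsize big_enum/= natr_prod.
rewrite -[X in _ * 2 ^+ X]card_ord -prodr_const -big_split/=.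
(* In every factor [s k + 1 <= 2 * s k], because [s k] is positive. *)
apply: ler_prod => k _; rewrite ler0n/= -natrM ler_nat.
by have := s0 k; lia.
Qed.

End MeanRecursion.

(** * Convergence for bounded functions, and reduction to independent subfamilies *)

Section Convergence.
Context d (X : measurableType d) (R : realType) (mu : probability X R).

Lemma norm_avg_le (T : X -> X) (f : X -> R) (K : R) s x :
  (forall y, `|f y| <= K) -> `|avg T f s.+1 x| <= K.
Proof.
move=> fK; rewrite /avg normrM ger0_norm ?invr_ge0// ler_pdivrMl//.
apply: le_trans (ler_norm_sum _ _ _) _.
apply: (@le_trans _ _ (\sum_(0 <= j < s.+1) K)); first exact: ler_sum.
by rewrite sumr_const_nat subn0 mulr_natl.
Qed.

Lemma null_seq_esups (u : nat -> X -> R) (g : X -> R) :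
  (forall s, measurable_fun setT (u s)) -> measurable_fun setT g ->
  {ae mu, forall x, u s x @[s --> \oo] --> g x} ->
  null_seq mu (fun N x => esups (fun s => `|u s x - g x|%:E) N).
Proof.
move=> mu_ mg aeu; split.
- move=> N; apply: measurable_fun_esups => s; apply/measurable_EFinP.
  by apply: measurableT_comp => //; exact: measurable_funB.
- move=> N x; apply: le_ereal_sup_tmp; eexists; first by exists N => /=.
  by rewrite lee_fin.
- by move=> N x; exact: nonincreasing_esups.
apply: filterS aeu => x /cvgrPdist_le ux e e0.
have [N _ uN] := ux e e0; exists N.
by apply: ge_ereal_sup => _ [s /= Ns <-]; rewrite lee_fin distrC; exact: uN.
Qed.

(** Birkhoff's theorem replaces the average over [U ord0] by its limit [f'], whose means over the
    other maps converge by induction. The error is bounded, hence has log levels of every order, so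
    iterated maximal functions make its means small. *)
Lemma mean_cvg_bounded n (U : 'I_n -> invertible_mpt mu) (f : X -> R) (K : R) :
  commuting U -> measurable_fun setT f -> (forall x, `|f x| <= K) ->
  exists g : X -> R,
    {ae mu, forall x, mean U f s x @[s --> multi_oo n] --> g x}.
Proof.
elim: n U f K => [|n IH] U f K hU mf fK.
  exists f; apply: aeW => x.
  have -> : (fun s => mean U f s x) = cst (f x) by apply/funext => s; rewrite mean0.
  exact: cvg_cst.
have mpU := mpt_funP (U ord0).
have [f' [mf' [K' f'K] aef']] := birkhoff_bounded mpU mf fK.
have [g aeg] := IH (tail_mpt U) f' K' (commuting_tail hU) mf' f'K.
exists g.
pose h N x := esups (fun s => `|avg (U ord0) f s.+1 x - f' x|%:E) N.
have nh : null_seq mu h.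
  by apply: null_seq_esups => // s; apply: measurable_avg => //; case: mpU.
have [_ h0 _ _] := nh.
have levh : log_levels mu n (h 0%N).
  apply: (@log_levels_bounded _ _ _ _ _ _ (K + K')) => x.
  apply: ge_ereal_sup => _ [s _ <-]; rewrite lee_fin.
  by rewrite (le_trans (ler_normB _ _))// lerD// norm_avg_le.
have boxh : box_null (tail_mpt U) (enum 'I_n) h.
  by apply: box_null_maxfuns nh levh _; rewrite size_enum_ord.
apply: filterS2 aeg boxh => x gx hx; apply/cvgrPdist_lt => e e0.
(* The power of 2 cancels the constant of [mean_le_of_boxsum], leaving [e / 4 <= e / 2]. *)
pose e' := e / 4 / 2 ^+ n.
have e'0 : 0 < e' by rewrite !divr_gt0// exprn_gt0.
have [N _ /(_ N (leqnn N)) hN] := hx e' e'0.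
move/cvgrPdist_lt : gx => /(_ (e / 2)); rewrite divr_gt0// => /(_ isT) [M _ gM].
(* [N.+1], since the averages in [h] are indexed by the predecessor of their length. *)
exists (maxn N.+1 M) => // s /= sNM.
have sN k : (N < s k)%N by apply: leq_trans (sNM k); rewrite leq_maxl.
have sM k : (M <= tail_size s k)%N by apply: leq_trans (sNM _); rewrite leq_maxr.
have {gM} := gM (tail_size s) sM => /= gM.
rewrite -(subrK (mean (tail_mpt U) f' (tail_size s) x) (g x)) -addrA.
apply: le_lt_trans (ler_normD _ _) _.
rewrite [ltRHS](splitr e) ltr_leD// distrC mean_inner -meanB.
apply: le_trans (ler_norm_mean _ _ _ _) _.
apply: (@le_trans _ _ (2 ^+ n * e')).
  apply: mean_le_of_boxsum (commuting_tail hU) (h0 N) _ _ (hN _) (ltW e'0).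
    move=> y; apply: ereal_sup_ubound; exists (s ord0).-1 => /=.
      by rewrite -ltnS prednK// (leq_trans _ (sN ord0)).
    by rewrite prednK// (leq_trans _ (sN ord0)).
  by move=> k; rewrite (leq_trans _ (sN _)).
rewrite /e' mulrC divfK ?expf_neq0//.
by rewrite ler_pM2l// lef_pV2 ?posrE// ler_nat.
Qed.

Lemma zact_big n (U : 'I_n -> invertible_mpt mu) (J : {set 'I_n}) p :
  zact U (enum J) p = \big[comp/idfun]_(k in J) mpt_zpow (U k) (p k).
Proof.
rewrite -big_filter (_ : seq.filter _ _ = enum J); last by rewrite [index_enum _]unlock.
by elim: (enum J) => [|k ks IH]; rewrite ?big_nil// big_cons /= IH.
Qed.

(** Induction on the size of [J]: an independent set has at most [rank U] elements, few enough for
    the maximal functions, and a dependent one loses an index through its relation. *)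
Lemma box_null_rank n (U : 'I_n -> invertible_mpt mu) m h (J : {set 'I_n}) :
  commuting U -> (rank U <= m.+1)%N -> null_seq mu h ->
  log_levels mu m (h 0%N) -> box_null U (enum J) h.
Proof.
move=> hU rU nh lev; have [_ h0 _ _] := nh.
have [c] := ubnP #|J|; elim: c J => // c IH J Jc.
have [[p [[k0 k0J pk0] aep]]|iJ] := pselect (dependent U J); last first.
  apply: box_null_maxfuns nh lev _; rewrite -cardE; apply: leq_trans rU.
  by rewrite /rank; apply: leq_bigmax_cond; exact/asboolP.
apply: (@box_null_dependent _ _ _ _ _ U hU (enum J) p) => //.
- exact: enum_uniq.
- by exists k0; rewrite ?mem_enum.
- by rewrite zact_big.
move=> k; rewrite mem_enum => kJ pk.
have -> : rem k (enum J) = enum (J :\ k).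
  rewrite rem_filter ?enum_uniq// /enum_mem -filter_predI.
  by apply: eq_filter => i; rewrite /= !inE.
by apply: IH; rewrite (cardsD1 k J) kJ in Jc.
Qed.

End Convergence.

(** * Truncation at height [N], and the conclusion *)

Section Truncation.
Context d (X : measurableType d) (R : realType) (mu : probability X R).
Variable f : X -> R.
Hypothesis mf : measurable_fun setT f.

Definition tail_set (N : nat) : set X := [set x | N%:R < `|f x|].

Definition trunc N (x : X) : R := \1_(~` tail_set N) x * f x.

Definition trunc_tail N (x : X) : \bar R := (\1_(tail_set N) x * `|f x|)%:E.

Lemma measurable_tail_set N : measurable (tail_set N).
Proof.
rewrite -[tail_set N]/[set x | (N%:R%:E < `|f x|%:E)%E].
by apply: measurable_level; apply/measurable_EFinP; exact: measurableT_comp.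
Qed.

Lemma measurable_trunc N : measurable_fun setT (trunc N).
Proof.
apply: measurable_funM => //; apply: measurable_indic.
by apply: measurableC; exact: measurable_tail_set.
Qed.

Lemma indic_setC (A : set X) x : \1_(~` A) x = 1 - \1_A x :> R.
Proof.
rewrite !indicE; have [xA|xA] := boolP (x \in A).
  by rewrite subrr memNset//; move: xA; rewrite inE => xA /(_ xA).
by rewrite subr0 mem_set//= => Ax; rewrite mem_set in xA.
Qed.

Lemma trunc_bounded N x : `|trunc N x| <= N%:R.
Proof.
rewrite /trunc indic_setC indicE; have [_|] := boolP (x \in tail_set N).
  by rewrite subrr mul0r normr0.
by rewrite notin_setE /tail_set/= => /negP; rewrite -leNgt subr0 mul1r.
Qed.

Lemma trunc_tailE N x : `|f x - trunc N x|%:E = trunc_tail N x.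
Proof.
rewrite /trunc_tail /trunc indic_setC mulrBl mul1r opprB addrC subrK.
by rewrite normrM ger0_norm.
Qed.

Lemma trunc_tail_ge0 N x : (0 <= trunc_tail N x)%E.
Proof. by rewrite lee_fin mulr_ge0. Qed.

Lemma measurable_trunc_tail N : measurable_fun setT (trunc_tail N).
Proof.
apply/measurable_EFinP; apply: measurable_funM; last exact: measurableT_comp.
by apply: measurable_indic; exact: measurable_tail_set.
Qed.

Lemma null_seq_trunc_tail : null_seq mu trunc_tail.
Proof.
split.
- exact: measurable_trunc_tail.
- exact: trunc_tail_ge0.
- move=> N x; rewrite lee_fin ler_wpM2r// !indicE ler_nat.
  have [|//] := boolP (x \in tail_set N.+1).
  rewrite inE /tail_set/= => Nx; rewrite mem_set//=.
  by rewrite (le_lt_trans _ Nx)// ler_nat.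
apply: aeW => x e e0; exists (Num.truncn `|f x|).+1.
rewrite lee_fin indicE memNset ?mul0r ?ltW// /tail_set/=.
by apply/negP; rewrite -leNgt ltW// truncnS_gt.
Qed.

Lemma trunc_tail_le N x : (trunc_tail N x <= `|f x|%:E)%E.
Proof. by rewrite lee_fin ler_piMl// indicE lern1 leq_b1. Qed.

End Truncation.

Theorem theorem1p2 (R : realType) (disp : measure_display)
    (X : measurableType disp) (mu : probability X R)
    (n : nat) (U : 'I_n -> invertible_mpt mu) (d : nat)
    (hcomm : commuting U) (hrank : rank U = d) (hd : (1 <= d)%N)
    (f : X -> R) (hf : LlogL mu d.-1 f) :
  {ae mu, forall x, cvg (mean U f s x @[s --> multi_oo n])}.
Proof.
have [mf _] := hf.
have nh := null_seq_trunc_tail mu mf.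
have levh : log_levels mu d.-1 (trunc_tail f 0).
  apply: le_log_levels (LlogL_log_levels hf).
  - exact: measurable_trunc_tail.
  - by apply/measurable_EFinP; exact: measurableT_comp.
  - by move=> x; exact: trunc_tail_le.
have rankd : (rank U <= d.-1.+1)%N by rewrite hrank prednK.
have := box_null_rank [set: 'I_n]%SET hcomm rankd nh levh.
rewrite (_ : enum [set: 'I_n]%SET = enum 'I_n); last by apply: eq_enum => k; rewrite inE.
move=> boxh.
have aeN : {ae mu, forall x, forall N, cvg (mean U (trunc f N) s x @[s --> multi_oo n])}.
  apply: ae_foralln => N.
  have [g aeg] := mean_cvg_bounded hcomm (measurable_trunc mf N) (trunc_bounded f N).
  by apply: filterS aeg => x gx; apply/cvg_ex; exists (g x).
apply: filterS2 boxh aeN => x hx cx.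
(* By completeness it suffices to find, for each [e], a ball of radius [e] that eventually contains
   the means; its centre is the limit for one truncation. *)
apply/cauchy_cvgP; apply: cauchy_exP => e e0.
pose e' := e / 4 / 2 ^+ n.
have e'0 : 0 < e' by rewrite !divr_gt0// exprn_gt0.
have [N _ /(_ N (leqnn N)) hN] := hx e' e'0.
have /cvg_ex[l] := cx N.
move/cvgrPdist_lt => /(_ (e / 2)); rewrite divr_gt0// => /(_ isT) [M _ lM].
(* The bound 1 keeps every side positive, as the comparison with box sums requires. *)
exists l; exists (maxn 1 M) => // s /= sM.
have s0 k : (0 < s k)%N by apply: leq_trans (sM k); rewrite leq_maxl.
have {}lM : `|l - mean U (trunc f N) s x| < e / 2.
  by apply: lM => k; apply: leq_trans (sM k); rewrite leq_maxr.
rewrite /ball/= -(subrK (mean U (trunc f N) s x) l) -addrA.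
apply: le_lt_trans (ler_normD _ _) _.
rewrite [ltRHS](splitr e) ltr_leD// distrC -meanB.
apply: le_trans (ler_norm_mean _ _ _ _) _.
apply: (@le_trans _ _ (2 ^+ n * e')).
  apply: mean_le_of_boxsum hcomm (trunc_tail_ge0 f N) _ s0 (hN _) (ltW e'0).
  by move=> y; rewrite trunc_tailE.
rewrite /e' mulrC divfK ?expf_neq0//.
by rewrite ler_pM2l// lef_pV2 ?posrE// ler_nat.
Qed.
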